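(* Let $n\geq 1$ be an integer, let $X_n=\{1,\ldots,n\}=\mathscr{QS}(\mathbb{C}^n)$ and let $\psi$ be the uniformly distributed probability measure on $X_n$, viewed as a state on $\mathbb{C}^n$. Then Wang's quantum automorphism group of $X_n$ coincides with the quantum semigroup of all maps $X_n\to X_n$ preserving $\psi$: $$\mathrm{Aut}(X_n)=\mathscr{Q}\text{-}\mathrm{Map}^{\psi}(X_n).$$
   Context: $\otimes$ is the minimal tensor product of $C^*$-algebras; $\mathrm{Mor}(A,B)$ is the set of nondegenerate $*$-homomorphisms from $A$ to the multiplier algebra $\mathrm{M}(B)$, composed and tensored through canonical extensions to multiplier algebras. $\mathrm{Aut}(X_n)=(A,\Delta)$, where $A$ is the universal (unital) $C^*$-algebra generated by elements $a_{ij}$, $i,j=1,\ldots,n$, with relations $a_{ij}^2=a_{ij}$, $a_{ij}^*=a_{ij}$, $\sum_{j=1}^n a_{ij}=I$ for each $i$, and $\sum_{i=1}^n a_{ij}=I$ for each $j$, and $\Delta(a_{ij})=\sum_{k=1}^n a_{ik}\otimes a_{kj}$. For a finite dimensional $C^*$-algebra $M$, the quantum family of all maps $\mathscr{QS}(M)\to\mathscr{QS}(M)$ is the pair $(\widetilde{A},\widetilde{\Phi})$, unique up to isomorphism, of a unital $C^*$-algebra and $\widetilde{\Phi}\in\mathrm{Mor}(M,M\otimes\widetilde{A})$ such that for every $C^*$-algebra $D$ and every $\Psi\in\mathrm{Mor}(M,M\otimes D)$ there is a unique $\Lambda\in\mathrm{Mor}(\widetilde{A},D)$ with $(\mathrm{id}\otimes\Lambda)\circ\widetilde{\Phi}=\Psi$.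 For a state $\omega$ on $M$, $\mathscr{Q}\text{-}\mathrm{Map}^{\omega}(\mathscr{QS}(M))=(\dot{A},\dot{\Delta})$, where $\dot{A}=\widetilde{A}/J$ with $J$ the closed two-sided ideal generated by $\{(\omega\otimes\mathrm{id})\widetilde{\Phi}(m)-\omega(m)I : m\in M\}$, $\dot{\Phi}\in\mathrm{Mor}(M,M\otimes\dot{A})$ is the composition of $\widetilde{\Phi}$ with ($\mathrm{id}\,\otimes$ the quotient map), and $\dot{\Delta}\in\mathrm{Mor}(\dot{A},\dot{A}\otimes\dot{A})$ is the unique morphism with $(\dot{\Phi}\otimes\mathrm{id})\circ\dot{\Phi}=(\mathrm{id}\otimes\dot{\Delta})\circ\dot{\Phi}$. Here $M=\mathbb{C}^n$ and $\omega=\psi$. The equality means equality up to the canonical isomorphism intertwining the comultiplications, under which $\dot{\Phi}(e_j)=\sum_{i=1}^n e_i\otimes a_{ij}$ for the standard basis $e_1,\ldots,e_n$ of $\mathbb{C}^n$. *)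

(* Defs.v *)
From HB Require Import structures.
From mathcomp Require Import all_boot all_order all_algebra.
From mathcomp Require Import all_classical all_reals interval_inference.
From mathcomp Require Import topology normedtype.
From mathcomp Require Import complex.

Set Implicit Arguments.
Unset Strict Implicit.
Unset Printing Implicit Defensive.

Import Order.TTheory GRing.Theory Num.Theory.
Import numFieldNormedType.Exports.

Local Open Scope classical_set_scope.
Local Open Scope ring_scope.

(** * C*-algebras, not necessarily unital *)

HB.mixin Record CompleteNormedModule_isCStar (R : realType) A
    of CompleteNormedModule R[i] A := {
  cmul : A -> A -> A ;
  cstar : A -> A ;
  cmulA : associative cmul ;
  cmulDl : left_distributive cmul +%R ;
  cmulDr : right_distributive cmul +%R ;
  cmulZl : forall (k : R[i]) x y, cmul (k *: x) y = k *: cmul x y ;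
  cmulZr : forall (k : R[i]) x y, cmul x (k *: y) = k *: cmul x y ;
  cstarK : involutive cstar ;
  cstarD : {morph cstar : x y / x + y} ;
  cstarZ : forall (k : R[i]) x, cstar (k *: x) = Num.conj k *: cstar x ;
  cstarM : forall x y, cstar (cmul x y) = cmul (cstar y) (cstar x) ;
  cnormM : forall x y, `|cmul x y| <= `|x| * `|y| ;
  cnorm_star : forall x, `|cmul (cstar x) x| = `|x| ^+ 2
}.

#[short(type="cstarType")]
HB.structure Definition CStar (R : realType) :=
  {A of CompleteNormedModule R[i] A & CompleteNormedModule_isCStar R A}.

(* The zero algebra is allowed, with unit 0. *)
HB.mixin Record CStar_isUnital (R : realType) A of CStar R A := {
  cone : A ;
  cmul1l : left_id cone cmul ;
  cmul1r : right_id cone cmul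
}.

#[short(type="unitalCstarType")]
HB.structure Definition UnitalCStar (R : realType) :=
  {A of CStar R A & CStar_isUnital R A}.

Notation "x ** y" := (cmul x y) (at level 40, left associativity) : ring_scope.

Definition star_hom (R : realType) (A B : cstarType R) (f : A -> B) : Prop :=
  [/\ linear f, {morph f : x y / x ** y} & {morph f : x / cstar x}].

Definition unital_star_hom (R : realType) (A B : unitalCstarType R)
    (f : A -> B) : Prop :=
  star_hom f /\ f cone = cone.

(** * Multipliers and morphisms *)

(* M(B) is realised as the *-algebra of adjointable operators of the Hilbert
   module B_B, whose inner product is <x, y> = x^* y.  Linearity, right
   B-linearity and boundedness of such operators are automatic.  An element b
   of B is the multiplier x |-> b x. *)
Definition adjoint (R : realType) (B : cstarType R) (T S : B -> B) : Prop :=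
  forall x y, cstar (T x) ** y = cstar x ** S y.

Definition multiplier (R : realType) (B : cstarType R) (T : B -> B) : Prop :=
  exists S, adjoint T S.

(* Mor(A, B): phi a : B -> B is the multiplier phi(a), so phi a x = phi(a) x.
   The last clause says that the span of phi(A) B is dense in B. *)
Definition Mor (R : realType) (A B : cstarType R) (phi : A -> B -> B) : Prop :=
  [/\ forall a, multiplier (phi a),
      forall (k : R[i]) a b x, phi (k *: a + b) x = k *: phi a x + phi b x,
      forall a b x, phi (a ** b) x = phi a (phi b x),
      forall a, adjoint (phi a) (phi (cstar a))
    & closure [set y | exists s : seq (A * B),
                         y = \sum_(p <- s) phi p.1 p.2] = setT].

(* A map into B, seen as a map into M(B). *)
Definition to_mult (R : realType) (A B : cstarType R) (f : A -> B) :
    A -> B -> B :=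
  fun a x => f a ** x.

Definition id_mor (R : realType) (A : cstarType R) : A -> A -> A :=
  to_mult (fun a : A => a).

(* For chi in Mor(B, C) and T in M(B), S is the image of T under the canonical
   extension of chi to M(B) -> M(C); S is determined by this condition because
   chi is nondegenerate. *)
Definition extends_to (R : realType) (B C : cstarType R) (chi : B -> C -> C)
    (T : B -> B) (S : C -> C) : Prop :=
  multiplier S /\ forall b c, S (chi b c) = chi (T b) c.

(* kappa = chi o phi *)
Definition is_comp (R : realType) (A B C : cstarType R)
    (chi : B -> C -> C) (phi : A -> B -> B) (kappa : A -> C -> C) : Prop :=
  forall a, extends_to chi (phi a) (kappa a).

(** * Minimal tensor products *)

Definition bilin (K : pzRingType) (U V W : lmodType K) (f : U -> V -> W) :
    Prop :=
  (forall u, linear (f u)) /\ (forall v, linear (f^~ v)).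

(* s stands for the sum of the u (x) v, (u, v) in s, in the algebraic tensor
   product of U and V; this element is zero iff every bilinear map kills it. *)
Definition alg_tensor_eq0 (K : pzRingType) (U V : lmodType K)
    (s : seq (U * V)) : Prop :=
  forall (W : lmodType K) (f : U -> V -> W), bilin f ->
    \sum_(p <- s) f p.1 p.2 = 0.

(* t induces an injective *-homomorphism from the algebraic tensor product of A
   and B to S, i.e. the norm of S restricts to a C*-norm on it. *)
Definition cstar_norm_map (R : realType) (A B S : cstarType R)
    (t : A -> B -> S) : Prop :=
  [/\ bilin t,
      forall a a' b b', t (a ** a') (b ** b') = t a b ** t a' b',
      forall a b, cstar (t a b) = t (cstar a) (cstar b)
    & forall s : seq (A * B), \sum_(p <- s) t p.1 p.2 = 0 -> alg_tensor_eq0 s].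

(* The completion of the algebraic tensor product in the least C*-norm.  Every
   C*-norm on it is a cross-norm, so [ptens_cross] excludes nothing. *)
Record minTensor (R : realType) (A B : cstarType R) := MinTensor {
  tens_sort :> cstarType R ;
  ptens : A -> B -> tens_sort ;
  ptens_cstar : cstar_norm_map ptens ;
  ptens_cross : forall a b, `|ptens a b| = `|a| * `|b| ;
  ptens_dense : closure [set x | exists s : seq (A * B),
                                   x = \sum_(p <- s) ptens p.1 p.2] = setT ;
  ptens_min : forall (S : cstarType R) (t : A -> B -> S), cstar_norm_map t ->
    forall s : seq (A * B),
      `|\sum_(p <- s) ptens p.1 p.2| <= `|\sum_(p <- s) t p.1 p.2|
}.

Arguments ptens {R A B m} a b.
Notation "a \ox b" := (ptens a b)
  (at level 38, left associativity) : ring_scope.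

(* A choice of a minimal tensor product (unique up to a canonical isomorphism)
   for every pair of C*-algebras. *)
Definition minTensorProduct (R : realType) :=
  forall A B : cstarType R, minTensor A B.

(* kappa = phi1 (x) phi2 *)
Definition is_tensor_mor (R : realType) (tp : minTensorProduct R)
    (A1 A2 B1 B2 : cstarType R)
    (phi1 : A1 -> B1 -> B1) (phi2 : A2 -> B2 -> B2)
    (kappa : tp A1 A2 -> tp B1 B2 -> tp B1 B2) : Prop :=
  Mor kappa /\
  forall a1 a2 b1 b2,
    kappa (a1 \ox a2) (b1 \ox b2) = phi1 a1 b1 \ox phi2 a2 b2.

(* The canonical isomorphism (A (x) B) (x) C -> A (x) (B (x) C). *)
Definition is_associator (R : realType) (tp : minTensorProduct R)
    (A B C : cstarType R)
    (alpha : tp (tp A B) C -> tp A (tp B C)) : Prop :=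
  [/\ star_hom alpha, bijective alpha &
      forall a b c, alpha ((a \ox b : tp A B) \ox c) =
                    a \ox (b \ox c : tp B C)].

(** * Quantum semigroups of maps *)

(* (At, Phi) is the quantum family of all maps QS(M) -> QS(M). *)
Definition quantum_family_all_maps (R : realType) (tp : minTensorProduct R)
    (M At : unitalCstarType R) (Phi : M -> tp M At -> tp M At) : Prop :=
  Mor Phi /\
  forall (D : cstarType R) (Psi : M -> tp M D -> tp M D), Mor Psi ->
    exists! Lambda : At -> D -> D,
      Mor Lambda /\
      exists K : tp M At -> tp M D -> tp M D,
        is_tensor_mor (@id_mor R M) Lambda K /\ is_comp K Phi Psi.

Definition is_state (R : realType) (M : unitalCstarType R) (omega : M -> R[i]) :
    Prop :=
  [/\ scalar omega, forall x, 0 <= omega (cstar x ** x) & omega cone = 1].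

(* sigma = omega (x) id *)
Definition is_slice (R : realType) (tp : minTensorProduct R)
    (M A : cstarType R) (omega : M -> R[i]) (sigma : tp M A -> A) : Prop :=
  [/\ linear sigma, continuous sigma &
      forall m a, sigma (m \ox a) = omega m *: a].

Definition closed_ideal (R : realType) (A : cstarType R) (J : set A) : Prop :=
  [/\ J 0,
      forall (k : R[i]) x y, J x -> J y -> J (k *: x + y),
      forall a x, J x -> J (a ** x),
      forall a x, J x -> J (x ** a)
    & closed J].

Definition is_quotient (R : realType) (A B : cstarType R) (J : set A)
    (q : A -> B) : Prop :=
  [/\ star_hom q,
      forall b, exists a, q a = b,
      forall a, q a = 0 <-> J a,
      forall a j, J j -> `|q a| <= `|a + j|
    & forall a (eps : R[i]), 0 < eps ->
        exists2 j, J j & `|a + j| < `|q a| + eps].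

(* M (x) At has unit 1 (x) 1, so Phi m (1 (x) 1) is the element of M (x) At
   which the multiplier Phi(m) is. *)
Definition preserving_gens (R : realType) (tp : minTensorProduct R)
    (M At : unitalCstarType R) (omega : M -> R[i])
    (Phi : M -> tp M At -> tp M At) : set At :=
  [set x | exists (sigma : tp M At -> At) (m : M),
     is_slice omega sigma /\
     x = sigma (Phi m (cone \ox cone)) - omega m *: cone].

(* (Phi (x) id) o Phi = (id (x) Delta) o Phi, up to the associator. *)
Definition comult_eq (R : realType) (tp : minTensorProduct R)
    (M A : unitalCstarType R) (Phi : M -> tp M A -> tp M A)
    (Delta : A -> tp A A -> tp A A) : Prop :=
  exists (alpha : tp (tp M A) A -> tp M (tp A A))
         (K1 : tp M A -> tp (tp M A) A -> tp (tp M A) A)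
         (K2 : tp M A -> tp M (tp A A) -> tp M (tp A A))
         (L1 : M -> tp (tp M A) A -> tp (tp M A) A)
         (L2 : M -> tp M (tp A A) -> tp M (tp A A)),
    is_associator alpha /\
    is_tensor_mor Phi (@id_mor R A) K1 /\ is_comp K1 Phi L1 /\
    is_tensor_mor (@id_mor R M) Delta K2 /\ is_comp K2 Phi L2 /\
    forall m x, alpha (L1 m x) = L2 m (alpha x).

(* (Ad, Delta) is the quantum semigroup Q-Map^omega(QS(M)), and Phi its action
   on QS(M). *)
Definition is_QMap (R : realType) (tp : minTensorProduct R)
    (M Ad : unitalCstarType R) (omega : M -> R[i])
    (Phi : M -> tp M Ad -> tp M Ad) (Delta : Ad -> tp Ad Ad -> tp Ad Ad) :
    Prop :=
  exists (At : unitalCstarType R) (Phit : M -> tp M At -> tp M At)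
         (q : At -> Ad),
    [/\ quantum_family_all_maps Phit,
        is_quotient (smallest (@closed_ideal R At)
                              (preserving_gens omega Phit)) q,
        Mor Phi /\
        (exists K : tp M At -> tp M Ad -> tp M Ad,
           is_tensor_mor (@id_mor R M) (to_mult q) K /\ is_comp K Phit Phi)
      & unique (fun D => Mor D /\ comult_eq Phi D) Delta].

(* theta intertwines the comultiplications:
   (theta (x) theta) o DeltaA = DeltaB o theta. *)
Definition intertwines (R : realType) (tp : minTensorProduct R)
    (A B : unitalCstarType R) (DeltaA : A -> tp A A -> tp A A)
    (DeltaB : B -> tp B B -> tp B B) (theta : A -> B) : Prop :=
  exists (Theta : tp A A -> tp B B -> tp B B) (kappa : A -> tp B B -> tp B B),
    [/\ is_tensor_mor (to_mult theta) (to_mult theta) Theta,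
        is_comp Theta DeltaA kappa
      & is_comp DeltaB (to_mult theta) kappa].

(** * Wang's quantum automorphism group of n points *)

Definition magic_relations (R : realType) (n : nat) (B : unitalCstarType R)
    (b : 'I_n -> 'I_n -> B) : Prop :=
  [/\ forall i j, b i j ** b i j = b i j,
      forall i j, cstar (b i j) = b i j,
      forall i, \sum_j b i j = cone
    & forall j, \sum_i b i j = cone].

(* (A, Delta) is Aut(X_n), with generators a. *)
Definition is_Aut (R : realType) (tp : minTensorProduct R) (n : nat)
    (A : unitalCstarType R) (a : 'I_n -> 'I_n -> A)
    (Delta : A -> tp A A -> tp A A) : Prop :=
  [/\ magic_relations a,
      forall (B : unitalCstarType R) (b : 'I_n -> 'I_n -> B),
        magic_relations b ->
        exists! f : A -> B, unital_star_hom f /\ forall i j, f (a i j) = b i j,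
      Mor Delta
    & forall i j x, Delta (a i j) x =
                    (\sum_k a i k \ox a k j : tp A A) ** x].

(** * The C*-algebra C^n *)

Definition Cn (R : realType) (n : nat) : Type := 'rV[R[i]]_n.

Lemma complex_complete (R : realType) (F : set_system (R[i] : numFieldType)) :
  ProperFilter F -> cauchy F -> cvg F.
Proof.
move=> FF /cauchyP Fc.
have nRe (z : R[i]) : (`|complex.Re z|)%:C%C <= `|z|.
  case: z => a b; rewrite normc_def lecR -sqrtr_sqr ler_wsqrtr //.
  by rewrite lerDl sqr_ge0.
have nIm (z : R[i]) : (`|complex.Im z|)%:C%C <= `|z|.
  case: z => a b; rewrite normc_def lecR -sqrtr_sqr ler_wsqrtr //.
  by rewrite lerDr sqr_ge0.
have cpart (p : R[i] -> R) :
    (forall x y, p (x - y) = p x - p y) -> (forall z, (`|p z|)%:C%C <= `|z|) ->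
    exists l : R, forall e : R, 0 < e -> F [set z | `|l - p z| < e].
  move=> pB np; have : cvg (p @ F).
    apply: R_complete; apply/cauchyP => e e0.
    have /Fc[x Fx] : 0 < e%:C%C :> R[i] by rewrite ltcR.
    exists (p x); change (F (p @^-1` ball (p x) e)); apply: filterS Fx => z.
    rewrite -!ball_normE /ball_ /= => xz.
    by move: (np (x - z)); rewrite pB => /le_lt_trans/(_ xz); rewrite ltcR.
  move=> /cvg_ex[l /cvgrPdist_lt pl]; exists l => e e0; exact: pl.
have [||a Fa] := cpart (@complex.Re R); [by case=> ? ? []|exact: nRe|].
have [||b Fb] := cpart (@complex.Im R); [by case=> ? ? []|exact: nIm|].
apply/cvg_ex; exists (a +i* b)%C; apply/cvgrPdist_lt => /= e e0.
have [e' e'0 ->] : exists2 e' : R, 0 < e' & e = e'%:C%C.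
  by case: e e0 => e1 e2; rewrite ltcE /= => /andP[/eqP-> e10]; exists e1.
have e2 : 0 < e' / 2 by rewrite divr_gt0.
have F' : Filter F := @filter_filter _ F FF.
have Fab := @filterI _ F F' _ _ (Fa _ e2) (Fb _ e2).
apply: (@filterS _ F F' _ _ _ Fab) => -[c d] /= [ac bd].
have -> : ((a +i* b) - (c +i* d) = (a - c)%:C + (0 +i* (b - d)) :> R[i])%C.
  by apply/eqP; rewrite eq_complex /= addr0 add0r !eqxx.
apply: le_lt_trans (ler_normD _ _) _.
rewrite !normc_def /= !expr0n /= addr0 add0r !sqrtr_sqr -rmorphD ltcR.
by rewrite (splitr e') ltrD.
Qed.

HB.instance Definition _ (R : realType) (n : nat) :=
  NormedModule.copy (Cn R n) 'rV[R[i]]_n.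

Lemma Cn_complete (R : realType) (n : nat) (F : set_system (Cn R n)) :
  ProperFilter F -> cauchy F -> cvg F.
Proof.
pose C := (R[i] : numFieldType).
pose T : completeType :=
  HB.pack (Num.NumField.sort C) (Uniform_isComplete.Build C (@complex_complete R)).
exact: (@mx_complete T 1 n F).
Qed.

HB.instance Definition _ (R : realType) (n : nat) :=
  Uniform_isComplete.Build (Cn R n) (@Cn_complete R n).

Lemma Cn_normP (R : realType) (n : nat) (x : Cn R n) (c : R[i]) :
  0 <= c -> (`|x| <= c) <-> (forall j, `|x ord0 j| <= c).
Proof.
move=> c0; rewrite [`|x|]mx_normE.
have -> : c = (NngNum c0)%:num by [].
rewrite num_le; split => [/bigmax_leP[_ H] j|H].
  by have := H (ord0, j) isT; rewrite -num_le.
by apply/bigmax_leP; split => // -[i j] _; rewrite -num_le /= ord1.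
Qed.

Lemma Cn_norm_ge (R : realType) (n : nat) (x : Cn R n) j :
  `|x ord0 j| <= `|x|.
Proof. by apply: (Cn_normP x (normr_ge0 x)).1. Qed.

Definition Cn_mul (R : realType) (n : nat) (x y : Cn R n) : Cn R n :=
  \row_j (x ord0 j * y ord0 j).

Definition Cn_star (R : realType) (n : nat) (x : Cn R n) : Cn R n :=
  \row_j Num.conj (x ord0 j).

Definition Cn_one (R : realType) (n : nat) : Cn R n := const_mx 1.

Section CnCStar.
Context (R : realType) (n : nat).
Implicit Types (x y z : Cn R n) (k : R[i]).

Lemma Cn_mulA : associative (@Cn_mul R n).
Proof. by move=> x y z; apply/rowP => j; rewrite !mxE mulrA. Qed.
Lemma Cn_mulDl : left_distributive (@Cn_mul R n) +%R.
Proof. by move=> x y z; apply/rowP => j; rewrite !mxE mulrDl. Qed.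
Lemma Cn_mulDr : right_distributive (@Cn_mul R n) +%R.
Proof. by move=> x y z; apply/rowP => j; rewrite !mxE mulrDr. Qed.
Lemma Cn_mulZl k x y : Cn_mul (k *: x) y = k *: Cn_mul x y.
Proof. by apply/rowP => j; rewrite !mxE mulrA. Qed.
Lemma Cn_mulZr k x y : Cn_mul x (k *: y) = k *: Cn_mul x y.
Proof. by apply/rowP => j; rewrite !mxE mulrCA. Qed.
Lemma Cn_starK : involutive (@Cn_star R n).
Proof. by move=> x; apply/rowP => j; rewrite !mxE conjCK. Qed.
Lemma Cn_starD : {morph @Cn_star R n : x y / x + y}.
Proof. by move=> x y; apply/rowP => j; rewrite !mxE rmorphD. Qed.
Lemma Cn_starZ k x : Cn_star (k *: x) = Num.conj k *: Cn_star x.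
Proof. by apply/rowP => j; rewrite !mxE rmorphM. Qed.
Lemma Cn_starM x y : Cn_star (Cn_mul x y) = Cn_mul (Cn_star y) (Cn_star x).
Proof. by apply/rowP => j; rewrite !mxE rmorphM mulrC. Qed.
Lemma Cn_normM x y : `|Cn_mul x y| <= `|x| * `|y|.
Proof.
apply/Cn_normP => [|j]; first by rewrite mulr_ge0.
by rewrite mxE normrM ler_pM // Cn_norm_ge.
Qed.
Lemma Cn_norm_star x : `|Cn_mul (Cn_star x) x| = `|x| ^+ 2.
Proof.
apply/eqP; rewrite eq_le; apply/andP; split.
  apply/Cn_normP => [|j]; first by rewrite exprn_ge0.
  by rewrite !mxE normrM norm_conjC -expr2 lerXn2r ?nnegrE // Cn_norm_ge.
have [->|x0] := eqVneq `|x| 0; first by rewrite expr0n /= normr_ge0.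
have [[i j] /= xij] := mx_norm_neq0 x0.
rewrite [`|x|]xij ord1.
apply: le_trans (Cn_norm_ge (Cn_mul (Cn_star x) x) j).
by rewrite !mxE normrM norm_conjC -expr2.
Qed.
Lemma Cn_mul1l : left_id (Cn_one R n) (@Cn_mul R n).
Proof. by move=> x; apply/rowP => j; rewrite !mxE mul1r. Qed.
Lemma Cn_mul1r : right_id (Cn_one R n) (@Cn_mul R n).
Proof. by move=> x; apply/rowP => j; rewrite !mxE mulr1. Qed.

End CnCStar.

HB.instance Definition _ (R : realType) (n : nat) :=
  CompleteNormedModule_isCStar.Build R (Cn R n)
    (@Cn_mulA R n) (@Cn_mulDl R n) (@Cn_mulDr R n) (@Cn_mulZl R n)
    (@Cn_mulZr R n) (@Cn_starK R n) (@Cn_starD R n) (@Cn_starZ R n)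
    (@Cn_starM R n) (@Cn_normM R n) (@Cn_norm_star R n).

HB.instance Definition _ (R : realType) (n : nat) :=
  CStar_isUnital.Build R (Cn R n) (@Cn_mul1l R n) (@Cn_mul1r R n).

Definition Cn_basis (R : realType) (n : nat) (j : 'I_n) : Cn R n :=
  delta_mx ord0 j.

(* The uniformly distributed probability measure on n points. *)
Definition unif_state (R : realType) (n : nat) (x : Cn R n) : R[i] :=
  \sum_j n%:R^-1 * x ord0 j.

Lemma unif_state_is_state (R : realType) (n : nat) :
  (0 < n)%N -> is_state (@unif_state R n).
Proof.
move=> n0; split=> [k x y|x|]; rewrite /unif_state.
- rewrite mulr_sumr -big_split /=; apply: eq_bigr => j _.
  by rewrite !mxE mulrDr mulrCA.
- apply: sumr_ge0 => j _; rewrite mulr_ge0 ?invr_ge0 ?ler0n //.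
  by rewrite !mxE mulrC mul_conjC_ge0.
- under eq_bigr do rewrite mxE mulr1.
  by rewrite sumr_const card_ord -[LHS]mulr_natl mulfV // pnatr_eq0 -lt0n.
Qed.

(* Main.v *)
Require Import Defs.
From HB Require Import structures.
From mathcomp Require Import all_boot all_order all_algebra.
From mathcomp Require Import all_classical all_reals topology normedtype.
From mathcomp Require Import complex.
Import Order.TTheory GRing.Theory Num.Theory.
Import numFieldNormedType.Exports.
Local Open Scope classical_set_scope.
Local Open Scope ring_scope.
Set Implicit Arguments.
Unset Strict Implicit.
Unset Printing Implicit Defensive.

(** A map of quantum spaces into C^n (x) B, with B unital, is a matrix: since
    every z in C^n (x) B is uniquely the sum of the e_i (x) z_i
    ([component_decomp]), a morphism Phi from C^n to C^n (x) B is given by the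
    entries u_ij in B with Phi(e_j) = sum_i e_i (x) u_ij.  That Phi is a unital
    *-homomorphism makes the entries of each row projections with sum 1.
    Preservation of the uniform measure says exactly that the columns have sum 1
    as well, because the slice of Phi(e_j) by the uniform state is 1/n times the
    j-th column sum.  So the quotient Ad of the universal algebra At carries a
    magic matrix v ([entries_magic]), and the universal property of A gives
    theta : A -> Ad with theta(a_ij) = v_ij.

    For the inverse, the matrix a has to define a morphism from C^n to
    C^n (x) A.  This needs a_ij a_ik = 0 for j <> k, which is not among the
    defining relations but holds for projections with sum 1 in any C*-algebra
    ([projections_orthogonal]).  The universal property of At then yields
    lambda : At -> A with lambda(u_ij) = a_ij.  It vanishes on the generators of
    the ideal J, hence on J, since the kernel of a unital *-homomorphism of
    C*-algebras is closed ([unital_star_hom_ker_closed]), and so it descends to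
    mu : Ad -> A ([quotient_lift]).  Uniqueness in the universal property of A
    gives mu o theta = id; uniqueness in that of At gives
    theta o lambda = q, hence theta o mu = id.

    The coaction identity for the comultiplication of Ad, read entry by entry,
    is Delta(v_ij) = sum_k v_ik (x) v_kj ([comult_entries]).  So
    Deltad o theta and (theta (x) theta) o Delta agree on the generators a_ij,
    hence everywhere.  Here theta (x) theta exists because theta is an
    isomorphism: minimality of the norm on Ad (x) Ad, applied to the C*-norm
    transported from A (x) A, bounds it ([tensor_iso]).

    The two facts about C*-algebras are obtained without functional calculus.
    Both rest on a square root of 1 - x for small self-adjoint x
    ([sqrt_one_sub]) and on the inequality |x^2| <= |x^2 + y^2| for commuting
    self-adjoint x and y ([cnorm_sum_squares]). *)

(** * Linear maps and arithmetic in a C*-algebra *)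

Section Linear.
Context (K : pzRingType) (U V : lmodType K) (f : U -> V).
Hypothesis f_lin : linear f.

Lemma lin0 : f 0 = 0.
Proof. by have := f_lin (-1) 0 0; rewrite scaler0 addr0 scaleN1r addNr. Qed.
Lemma linD x y : f (x + y) = f x + f y.
Proof. by rewrite -[x in LHS]scale1r f_lin scale1r. Qed.
Lemma linZ k x : f (k *: x) = k *: f x.
Proof. by rewrite -[_ *: _ in LHS]addr0 f_lin lin0 addr0. Qed.
Lemma linB x y : f (x - y) = f x - f y.
Proof. by rewrite -scaleN1r linD linZ scaleN1r. Qed.
Lemma lin_sum I (r : seq I) (P : pred I) (F : I -> U) :
  f (\sum_(i <- r | P i) F i) = \sum_(i <- r | P i) f (F i).
Proof. exact: (big_morph f linD lin0). Qed.
End Linear.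

Section CStarBasics.
Context (R : realType) (B : cstarType R).
Implicit Types (x y z : B) (k : R[i]).

Lemma cmul_linr x : linear (cmul x).
Proof. by move=> k y z; rewrite cmulDr cmulZr. Qed.
Lemma cmul_linl y : linear (cmul^~ y).
Proof. by move=> k x z; rewrite cmulDl cmulZl. Qed.

Definition cmul0r x : x ** 0 = 0 := lin0 (cmul_linr x).
Definition cmul0l x : 0 ** x = 0 := lin0 (cmul_linl x).
Definition cmulBr x y z : x ** (y - z) = x ** y - x ** z := linB (cmul_linr x) y z.
Definition cmulBl x y z : (y - z) ** x = y ** x - z ** x := linB (cmul_linl x) y z.
Lemma cmulNr x y : x ** (- y) = - (x ** y).
Proof. by rewrite -scaleN1r cmulZr scaleN1r. Qed.
Lemma cmulNl x y : (- x) ** y = - (x ** y).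
Proof. by rewrite -scaleN1r cmulZl scaleN1r. Qed.
Lemma cmul_sumr I (r : seq I) (P : pred I) (F : I -> B) x :
  x ** (\sum_(i <- r | P i) F i) = \sum_(i <- r | P i) x ** F i.
Proof. exact: (lin_sum (cmul_linr x)). Qed.
Lemma cmul_suml I (r : seq I) (P : pred I) (F : I -> B) x :
  (\sum_(i <- r | P i) F i) ** x = \sum_(i <- r | P i) F i ** x.
Proof. exact: (lin_sum (cmul_linl x)). Qed.

Lemma cstarN x : cstar (- x) = - cstar x.
Proof. by rewrite -scaleN1r cstarZ rmorphN rmorph1 scaleN1r. Qed.
Lemma cstarB x y : cstar (x - y) = cstar x - cstar y.
Proof. by rewrite cstarD cstarN. Qed.
Lemma cstar0 : cstar (0 : B) = 0.
Proof. by have := cstarB (0 : B) 0; rewrite !subrr. Qed.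
Lemma cstar_sum I (r : seq I) (P : pred I) (F : I -> B) :
  cstar (\sum_(i <- r | P i) F i) = \sum_(i <- r | P i) cstar (F i).
Proof. exact: (big_morph (@cstar R B) (@cstarD R B) cstar0). Qed.

(** From |x|^2 = |x^* x| <= |x^*| |x| one gets |x| <= |x^*|, and then equality
    because the involution is its own inverse. *)
Lemma cnorm_cstar x : `|cstar x| = `|x|.
Proof.
have le y : `|y| <= `|cstar y|.
  have [->|y0] := eqVneq y 0; first by rewrite cstar0.
  rewrite -(ler_pM2r (x := `|y|)) ?normr_gt0 // -expr2 -cnorm_star.
  exact: cnormM.
by apply/eqP; rewrite eq_le le andbT -{2}(cstarK x) le.
Qed.

Lemma cstar_mul_eq0 x : cstar x ** x = 0 -> x = 0.
Proof.
move=> /(congr1 (fun y => `|y|)); rewrite cnorm_star normr0 => /eqP.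
by rewrite expf_eq0 /= normr_eq0 => /eqP.
Qed.

Lemma cnorm_sa x : cstar x = x -> `|x ** x| = `|x| ^+ 2.
Proof. by move=> xs; rewrite -cnorm_star xs. Qed.

Lemma projection_norm_le1 x : cstar x = x -> x ** x = x -> `|x| <= 1.
Proof.
move=> xs xx; have := cnorm_sa xs; rewrite xx => h.
have [->|x0] := eqVneq x 0; first by rewrite normr0.
have : `|x| != 0 by rewrite normr_eq0.
by move/mulfI => /(_ `|x| 1); rewrite mulr1 -expr2 -h => ->.
Qed.

End CStarBasics.

(** * Density *)

Section Density.
Context (R : realType).
Implicit Types V W : normedModType R[i].

Lemma closure_approx V (S : set V) (x : V) (e : R[i]) :
  closure S x -> 0 < e -> exists2 y, S y & `|x - y| < e.
Proof.
move=> /(_ (ball x e)) + e0 => -[|y [Sy]]; first exact: nbhsx_ballx.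
by rewrite -ball_normE; exists y.
Qed.

(** The scalars are complex, so their order is partial and the usual argument by
    contradiction on a < c e is replaced by the choice e = a / (c + 1). *)
Lemma le_eps_eq0 (a c : R[i]) :
  0 <= a -> 0 <= c -> (forall e, 0 < e -> a <= c * e) -> a = 0.
Proof.
move=> a0 c0 h; apply/eqP; apply/contraT => an0.
have ap : 0 < a by rewrite lt_def an0.
have c1 : 0 < c + 1 by rewrite ltr_wpDl.
have := h (a / (c + 1)) (divr_gt0 ap c1).
rewrite mulrCA ler_pMr // ler_pdivlMr // mul1r.
by rewrite gerDl lt_geF.
Qed.

(** Boundedness is taken in the form |f x| <= c |x| throughout, since most of the
    maps below come with such a bound rather than with a proof of continuity. *)
Lemma dense_eq V W (S : set V) (f g : V -> W) (cf cg : R[i]) :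
  closure S = setT -> linear f -> linear g -> 0 <= cf -> 0 <= cg ->
  (forall x, `|f x| <= cf * `|x|) -> (forall x, `|g x| <= cg * `|x|) ->
  (forall x, S x -> f x = g x) -> f =1 g.
Proof.
move=> Sd fl gl cf0 cg0 fb gb fg x; apply/eqP; rewrite -subr_eq0 -normr_eq0.
apply/eqP; apply: (@le_eps_eq0 _ (cf + cg)) => // [|e e0]; first exact: addr_ge0.
have [|y Sy xy] := @closure_approx _ S x e _ e0; first by rewrite Sd.
have -> : f x - g x = f (x - y) - g (x - y).
  by rewrite (linB fl) (linB gl) (fg y) // opprB addrA subrK.
apply: le_trans (ler_normB _ _) _; rewrite mulrDl lerD //.
  by apply: le_trans (fb _) _; rewrite ler_wpM2l // ltW.
by apply: le_trans (gb _) _; rewrite ler_wpM2l // ltW.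
Qed.
End Density.

(** * Bounded linear maps out of a minimal tensor product *)

Section TensorExt.
Context (R : realType) (A B : cstarType R) (T : minTensor A B).

Definition ptens_lin := let: And4 h _ _ _ := @ptens_cstar R A B T in h.
Lemma ptens_linr a : linear (@ptens R A B T a).
Proof. exact: ptens_lin.1. Qed.
Lemma ptens_linl b : linear (@ptens R A B T ^~ b).
Proof. exact: ptens_lin.2. Qed.
Definition ptensM := let: And4 _ h _ _ := @ptens_cstar R A B T in h.
Definition ptens_star := let: And4 _ _ h _ := @ptens_cstar R A B T in h.

Lemma tens_eq (W : normedModType R[i]) (f g : T -> W) (cf cg : R[i]) :
  linear f -> linear g -> 0 <= cf -> 0 <= cg ->
  (forall x, `|f x| <= cf * `|x|) -> (forall x, `|g x| <= cg * `|x|) ->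
  (forall a b, f (a \ox b) = g (a \ox b)) -> f =1 g.
Proof.
move=> fl gl cf0 cg0 fb gb fg.
apply: (dense_eq (@ptens_dense R A B T) fl gl cf0 cg0 fb gb) => _ [s ->].
by rewrite (lin_sum fl) (lin_sum gl); apply: eq_bigr => -[a b] _ /=.
Qed.

(** Extension by continuity from the algebraic tensor product.  The bound makes t
    factor through the finite sums, and completeness of W gives the values on
    limits of such sums. *)
Lemma tens_extend (W : completeNormedModType R[i]) (t : A -> B -> W) :
  bilin t ->
  (forall s : seq (A * B), `|\sum_(p <- s) t p.1 p.2|
                            <= `|\sum_(p <- s) p.1 \ox p.2 : T|) ->
  exists f : T -> W,
    [/\ linear f, forall x, `|f x| <= `|x| & forall a b, f (a \ox b) = t a b].
Proof.
move=> [tr tl] tb.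
pose F (s : seq (A * B)) : T := \sum_(p <- s) p.1 \ox p.2.
pose G (s : seq (A * B)) : W := \sum_(p <- s) t p.1 p.2.
pose comb (k : R[i]) (s s' : seq (A * B)) := [seq (k *: p.1, p.2) | p <- s] ++ s'.
have Fcomb k s s' : F (comb k s s') = k *: F s + F s'.
  rewrite /F /comb big_cat big_map /= scaler_sumr; congr (_ + _).
  by apply: eq_bigr => p _; rewrite (linZ (ptens_linl _)).
have Gcomb k s s' : G (comb k s s') = k *: G s + G s'.
  rewrite /G /comb big_cat big_map /= scaler_sumr; congr (_ + _).
  by apply: eq_bigr => p _; rewrite (linZ (tl _)).
have GF s s' : `|G s - G s'| <= `|F s - F s'|.
  have := tb (comb (-1) s' s); rewrite -/(F _) -/(G _) Fcomb Gcomb !scaleN1r.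
  by rewrite ![- _ + _]addrC.
(* Near x, the values of G on the finite sums close to x form a Cauchy filter;
   its limit is the value of the extension at x. *)
pose D (x : T) : set_system (seq (A * B)) :=
  filter_from (nbhs x) (fun N => F @^-1` N).
have DF x : ProperFilter (D x).
  apply: filter_from_proper => [|N Nx].
    apply: filter_from_filter; first by exists setT; exact: filterT.
    by move=> M N Mx Nx; exists (M `&` N) => //; exact: filterI.
  have : closure [set y | exists s, y = F s] x by rewrite (ptens_dense T).
  by move=> /(_ N Nx)[_ [[s ->] Ns]]; exists s.
have Dnear x e : 0 < e -> D x [set s | `|x - F s| < e].
  move=> e0; exists (ball x e); first exact: nbhsx_ballx.
  by move=> s /=; rewrite -ball_normE.
have Gcvg x : cvg (G @ D x).
  apply: cauchy_cvg; apply: cauchy_exP => e e0.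
  have e2 : 0 < e / 2 by rewrite divr_gt0.
  have [s0 /= xs0] := filter_ex (Dnear x _ e2).
  exists (G s0); apply: filterS (Dnear x _ e2) => s /= xs.
  rewrite -ball_normE /=; apply: le_lt_trans (GF _ _) _.
  rewrite (splitr e) -(subrK x (F s0)) -addrA.
  by apply: le_lt_trans (ler_normD _ _) _; rewrite ltrD // distrC.
pose f x := lim (G @ D x).
have fP x e : 0 < e -> exists s, `|x - F s| < e /\ `|f x - G s| < e.
  move=> e0; have Gx : G @ D x --> f x := Gcvg x.
  have Fn := @filter_filter _ _ (DF x).
  have h := proj1 (cvgrPdist_lt _ _) Gx e e0.
  have [s [h1 h2]] := filter_ex (filterI (Dnear x _ e0) (h Fn)).
  by exists s.
have fF s : f (F s) = G s.
  apply/eqP; rewrite -subr_eq0 -normr_eq0; apply/eqP.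
  apply: (@le_eps_eq0 _ _ 2) => // e e0.
  have [s' [h1 h2]] := fP (F s) e e0.
  rewrite -(subrK (G s') (f _)) -addrA; apply: le_trans (ler_normD _ _) _.
  rewrite mulr_natl mulr2n lerD ?(ltW h2) // distrC.
  by apply: le_trans (GF _ _) _; exact: ltW.
have fD k x y : f (k *: x + y) = k *: f x + f y.
  apply/eqP; rewrite -subr_eq0 -normr_eq0; apply/eqP.
  apply: (@le_eps_eq0 _ _ (2 * (`|k| + 1 + 1))) => // [|e e0].
    by rewrite mulr_ge0 // !addr_ge0.
  have [s [h1 h2]] := fP x e e0; have [s' [h1' h2']] := fP y e e0.
  have [u [h3 h4]] := fP (k *: x + y) e e0.
  have lt_comb (V : normedModType R[i]) (a b c d : V) : `|a - b| < e ->
      `|c - d| < e -> `|k *: b + d - (k *: a + c)| <= (`|k| + 1) * e.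
    move=> ab cd; have -> : k *: b + d - (k *: a + c) = k *: (b - a) + (d - c).
      by rewrite scalerBr opprD addrACA.
    rewrite mulrDl mul1r; apply: le_trans (ler_normD _ _) _.
    by rewrite normrZ lerD ?ler_wpM2l // distrC ltW.
  have -> : f (k *: x + y) - (k *: f x + f y) =
      (f (k *: x + y) - G u) + ((G u - G (comb k s s')) +
       (G (comb k s s') - (k *: f x + f y))).
    by rewrite !addrA !subrK.
  apply: le_trans (ler_normD _ _) _.
  apply: le_trans (lerD (ltW h4) (ler_normD _ _)) _.
  have -> : 2 * (`|k| + 1 + 1) * e = e + ((e + (`|k| + 1) * e) + (`|k| + 1) * e).
    rewrite -mulrA (mulrDl (`|k| + 1) 1) mul1r mulr_natl mulr2n.
    rewrite [_ * e + e]addrC -[LHS]addrA; congr (_ + _); exact: addrC.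
  rewrite lerD // lerD //; last by rewrite Gcomb lt_comb.
  apply: le_trans (GF _ _) _.
  have -> : F u - F (comb k s s') =
      (F u - (k *: x + y)) + ((k *: x + y) - F (comb k s s')).
    by rewrite addrA subrK.
  apply: le_trans (ler_normD _ _) _; rewrite lerD //; first by rewrite distrC ltW.
  by rewrite distrC Fcomb lt_comb.
exists f; split=> // [x|a b].
  rewrite -subr_le0; apply/ler_addgt0Pr => e e0; rewrite add0r.
  have e2 : 0 < e / 2 by rewrite divr_gt0.
  have [s [h1 h2]] := fP x _ e2.
  rewrite lerBlDr (splitr e) -addrA.
  rewrite -(subrK (G s) (f x)); apply: le_trans (ler_normD _ _) _.
  rewrite lerD ?(ltW h2) //.
  have := GF s [::]; rewrite /F /G !big_nil !subr0 => /le_trans; apply.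
  rewrite -/(F s) -(subrK x (F s)); apply: le_trans (ler_normD _ _) _.
  by rewrite lerD // distrC ltW.
by have := fF [:: (a, b)]; rewrite /F /G !big_seq1.
Qed.

End TensorExt.

(** * Star-homomorphisms out of tensor products, and morphisms between unital
    algebras *)

(** Tensor products of unital algebras are only C*-algebras by their type, so the
    unit is kept as an element with a property. *)
Definition cunit (R : realType) (B : cstarType R) (e : B) : Prop :=
  left_id e (@cmul R B) /\ right_id e (@cmul R B).

Lemma cone_unit (R : realType) (B : unitalCstarType R) : cunit (cone : B).
Proof. by split; [exact: cmul1l|exact: cmul1r]. Qed.

Section StarHoms.
Context (R : realType).

Lemma star_hom_comp (A B C : cstarType R) (f : A -> B) (g : B -> C) :
  star_hom f -> star_hom g -> star_hom (g \o f).
Proof.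
move=> [fl fm fs] [gl gm gs]; split=> [k x y|x y|x] /=.
- by rewrite fl gl.
- by rewrite fm gm.
- by rewrite fs gs.
Qed.

(** Both sides of f (x y) = f x f y are linear and bounded in each variable, so the
    identity passes from pure tensors to everything, one variable at a time.  For
    the involution, which is antilinear, the linear map x |-> f (x^* )^* is
    compared with f. *)
Lemma star_hom_tensor (A B C : cstarType R) (T : minTensor A B) (f : T -> C) :
  linear f -> (forall x, `|f x| <= `|x|) ->
  (forall a b a' b', f (a \ox b ** (a' \ox b')) = f (a \ox b) ** f (a' \ox b')) ->
  (forall a b, f (cstar (a \ox b)) = cstar (f (a \ox b))) ->
  star_hom f.
Proof.
move=> fl fb fm fs; split=> // [x y|x].
  have hm u : linear (fun z => f (u ** z)).
    by move=> k z z'; rewrite cmul_linr fl.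
  have hm' u : linear (fun z => f u ** f z).
    by move=> k z z'; rewrite fl cmul_linr.
  have bm u z : `|f (u ** z)| <= `|u| * `|z|.
    by apply: le_trans (fb _) _; exact: cnormM.
  have bm' u z : `|f u ** f z| <= `|u| * `|z|.
    by apply: le_trans (cnormM _ _) _; rewrite ler_pM.
  move: y; apply: (tens_eq (hm x) (hm' x) _ _ (bm x) (bm' x)) => // a b.
  move: x; apply: (@tens_eq _ _ _ _ _ (fun x => f (x ** (a \ox b)))
    (fun x => f x ** f (a \ox b)) `|a \ox b : T| `|a \ox b : T|) => //.
  - by move=> k z z'; rewrite cmul_linl fl.
  - by move=> k z z'; rewrite fl cmul_linl.
  - by move=> x; rewrite mulrC.
  - by move=> x; rewrite mulrC.
rewrite -[LHS]cstarK; congr cstar.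
move: x; apply: (@tens_eq _ _ _ _ _ (fun x => cstar (f (cstar x))) f 1 1) => //.
- by move=> k x y; rewrite cstarD cstarZ fl cstarD cstarZ conjCK.
- by move=> x; rewrite cnorm_cstar mul1r (le_trans (fb _)) // cnorm_cstar.
- by move=> x; rewrite mul1r.
- by move=> a b; rewrite fs cstarK.
Qed.

(** The sums of f' a (x) g' b define a C*-norm on the algebraic tensor product of
    A' and B', so minimality of the norm of T' bounds the map
    a (x) b |-> f a (x) g b by the norm of T. *)
Lemma tensor_iso (A A' B B' : cstarType R) (T : minTensor A B)
    (T' : minTensor A' B') (f : A -> A') (f' : A' -> A) (g : B -> B')
    (g' : B' -> B) :
  star_hom f -> star_hom f' -> star_hom g -> star_hom g' ->
  cancel f f' -> cancel f' f -> cancel g g' -> cancel g' g ->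
  exists F : T -> T', star_hom F /\ forall a b, F (a \ox b) = f a \ox g b.
Proof.
move=> [fl fm fs] [fl' fm' fs'] [gl gm gs] [gl' gm' gs'] fK fK' gK gK'.
have tn : cstar_norm_map (fun a b => f' a \ox g' b : T).
  split=> [||a b|s].
  - split=> [a|b] k x y; first by rewrite gl' ptens_linr.
    by rewrite fl' ptens_linl.
  - by move=> a a' b b'; rewrite fm' gm' ptensM.
  - by rewrite ptens_star fs' gs'.
  - move=> s0 W h [hr hl].
    have [_ _ _ inj] := @ptens_cstar R A B T.
    have := inj [seq (f' p.1, g' p.2) | p <- s]; rewrite big_map => /(_ s0 W).
    move=> /(_ (fun a b => h (f a) (g b))); rewrite big_map /=.
    under eq_bigr do rewrite fK' gK'.
    by apply; split=> [u|v] k x y; rewrite ?gl ?hr // fl hl.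
have [|s|F [Fl Fb Ft]] := @tens_extend R A B T T' (fun a b => f a \ox g b) _ _.
- by split=> [a|b] k x y; [rewrite gl ptens_linr|rewrite fl ptens_linl].
- have := @ptens_min R A' B' T' T _ tn [seq (f p.1, g p.2) | p <- s].
  rewrite !big_map /= => /le_trans; apply; rewrite le_eqVlt; apply/orP; left.
  by apply/eqP; congr `|_|; apply: eq_bigr => p _; rewrite fK gK.
exists F; split=> //; apply: star_hom_tensor => // [a b a' b'|a b].
  by rewrite -ptensM !Ft fm gm ptensM.
by rewrite ptens_star !Ft fs gs ptens_star.
Qed.

End StarHoms.

Section Multipliers.
Context (R : realType).

Lemma cunit_star (B : cstarType R) (e : B) : cunit e -> cstar e = e.
Proof.
move=> [el _]; have := congr1 (@cstar R B) (el (cstar e)).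
by rewrite cstarM cstarK el.
Qed.

Lemma cunit_tensor (A B : cstarType R) (T : minTensor A B) (eA : A) (eB : B) :
  cunit eA -> cunit eB -> cunit (eA \ox eB : T).
Proof.
move=> [lA rA] [lB rB]; split.
  apply: (@tens_eq _ _ _ _ _ (cmul (eA \ox eB)) id `|eA \ox eB : T| 1) => //.
  - exact: cmul_linr.
  - by move=> x; exact: cnormM.
  - by move=> x; rewrite mul1r.
  - by move=> a b; rewrite -ptensM lA lB.
apply: (@tens_eq _ _ _ _ _ (cmul^~ (eA \ox eB)) id `|eA \ox eB : T| 1) => //.
- exact: cmul_linl.
- by move=> x; rewrite mulrC; exact: cnormM.
- by move=> x; rewrite mul1r.
- by move=> a b; rewrite -ptensM rA rB.
Qed.

(** The adjoint S of T satisfies S y = (T e)^* y, and taking adjoints back gives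
    the claim.  So a morphism into M(B), for B unital, is a map into B. *)
Lemma multiplier_unit (B : cstarType R) (e : B) (T : B -> B) :
  cunit e -> multiplier T -> forall x, T x = T e ** x.
Proof.
move=> eu [S TS] x; have es := cunit_star eu; case: eu => el er.
have Se y : S y = cstar (T e) ** y by rewrite TS es el.
by have := TS x e; rewrite Se !er => /(congr1 (@cstar R B)); rewrite cstarK cstarM !cstarK.
Qed.

Section Mor.
Context (A B : cstarType R) (e : B) (phi : A -> B -> B).
Hypotheses (eu : cunit e) (phiM : Mor phi).

Lemma Mor_mul a x : phi a x = phi a e ** x.
Proof. by case: phiM => m _ _ _ _; exact: multiplier_unit. Qed.

Lemma Mor_star_hom : star_hom (phi^~ e).
Proof.
case: phiM => _ pl pm pa _; split=> [k x y|x y|x]; first exact: pl.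
  by rewrite pm Mor_mul.
have := pa x e e; rewrite (cunit_star eu); case: eu => el er.
by rewrite el er.
Qed.

(** phi(1) acts as the identity on the span of phi(A) B, which is dense. *)
Lemma Mor_unit (eA : A) : cunit eA -> phi eA e = e.
Proof.
move=> [eAl _]; case: phiM => _ _ pm _ pd.
suff h x : phi eA e ** x = x by rewrite -[LHS](proj2 eu) h.
move: x.
apply: (@dense_eq _ _ _ _ (cmul (phi eA e)) id `|phi eA e| 1 pd) => //.
- exact: cmul_linr.
- by move=> x; exact: cnormM.
- by move=> x; rewrite mul1r.
- move=> _ [s ->]; rewrite cmul_sumr; apply: eq_bigr => p _.
  by rewrite -Mor_mul -pm eAl.
Qed.
End Mor.

Lemma to_mult_Mor (A B : cstarType R) (eA : A) (e : B) (f : A -> B) :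
  cunit e -> star_hom f -> f eA = e -> Mor (to_mult f).
Proof.
move=> [el er] [fl fm fs] fe; split=> [a|k a b x|a b x|a x y|].
- by exists (cmul (f (cstar a))) => x y; rewrite /to_mult cstarM fs cmulA.
- by rewrite /to_mult fl cmulDl cmulZl.
- by rewrite /to_mult fm cmulA.
- by rewrite /to_mult cstarM fs cmulA.
- rewrite -subTset => y _; apply: subset_closure.
  by exists [:: (eA, y)]; rewrite big_seq1 /to_mult /= fe el.
Qed.

End Multipliers.

(** * Tensor products with C^n *)

Section Coordinates.
Context (R : realType) (n : nat).
Local Notation e_ := (@Cn_basis R n).

Lemma Cn_basisM j (x : Cn R n) : e_ j ** x = x ord0 j *: e_ j.
Proof.
apply/rowP => i; rewrite !mxE eqxx /=.
by have [->|_] := eqVneq i j; rewrite ?mulr0 ?mul0r // mul1r mulr1.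
Qed.

Lemma Cn_basis_star j : cstar (e_ j) = e_ j.
Proof.
apply/rowP => i; rewrite !mxE eqxx /=.
by case: eqVneq; rewrite ?conjC1 ?conjC0.
Qed.

(** A nonzero self-adjoint idempotent has norm 1, by the C*-identity. *)
Lemma Cn_basis_norm j : `|e_ j| = 1.
Proof.
have h : e_ j ** e_ j = e_ j by rewrite Cn_basisM mxE !eqxx scale1r.
have := cnorm_sa (Cn_basis_star j); rewrite h => /eqP.
rewrite -subr_eq0 expr2 -{1}[`|_|]mul1r -mulrBl mulf_eq0 subr_eq0.
case/orP => [/eqP //|]; rewrite normr_eq0 => /eqP/rowP/(_ j).
by rewrite !mxE !eqxx => /eqP; rewrite oner_eq0.
Qed.

Lemma Cn_decomp (x : Cn R n) : x = \sum_j x ord0 j *: e_ j.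
Proof. exact: row_sum_delta. Qed.

Lemma Cn_cone_sum : (cone : Cn R n) = \sum_j e_ j.
Proof. by rewrite [LHS]Cn_decomp; apply: eq_bigr => j _; rewrite mxE scale1r. Qed.

Section Coord.
Context (B : cstarType R) (T : minTensor (Cn R n) B).

(** The k-th component of w = sum_i e_i (x) y_i is bounded by |w|: multiplying w
    by e_k (x) y_k^* gives e_k (x) y_k^* y_k, of norm |y_k|^2, because the norm is a
    cross-norm.  Hence the coordinate maps extend to the completion. *)
Lemma component_exists k : exists c : T -> B,
  [/\ star_hom c, forall z, `|c z| <= `|z|
    & forall m b, c (m \ox b) = m ord0 k *: b].
Proof.
have [|s|c [cl cb ct]] := @tens_extend R _ _ T B (fun m b => m ord0 k *: b).
- split=> [m l x y|b l x y]; first by rewrite scalerDr !scalerA mulrC.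
  by rewrite !mxE scalerDl scalerA.
- set y := (X in `|X| <= _); set w := (X in _ <= `|X|).
  have h : (e_ k \ox cstar y) ** w = e_ k \ox (cstar y ** y).
    rewrite cmul_sumr cmul_sumr (lin_sum (ptens_linr _ _)).
    apply: eq_bigr => p _; rewrite -ptensM Cn_basisM (linZ (ptens_linl _ _)).
    by rewrite cmulZr (linZ (ptens_linr _ _)).
  have := cnormM (e_ k \ox cstar y) w; rewrite h !ptens_cross Cn_basis_norm !mul1r.
  rewrite cnorm_star cnorm_cstar expr2.
  have [->|y0] := eqVneq y 0; first by rewrite normr0.
  by rewrite ler_pM2l // normr_gt0.
exists c; split=> //; apply: star_hom_tensor => // [a b a' b'|a b].
  by rewrite -ptensM !ct mxE cmulZl cmulZr scalerA.
by rewrite ptens_star !ct mxE cstarZ.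
Qed.

Definition component k : T -> B := sval (cid (component_exists k)).

Lemma component_star_hom k : star_hom (component k).
Proof. by rewrite /component; case: cid => c []. Qed.
Lemma component_norm k z : `|component k z| <= `|z|.
Proof. by rewrite /component; case: cid => c []. Qed.
Lemma component_tensor k m b : component k (m \ox b) = m ord0 k *: b.
Proof. by rewrite /component; case: cid => c []. Qed.
Lemma component_lin k : linear (component k).
Proof. by case: (component_star_hom k). Qed.

Lemma component_sum k (x : 'I_n -> B) : component k (\sum_i e_ i \ox x i) = x k.
Proof.
rewrite (lin_sum (component_lin k)) (bigD1 k) //= component_tensor mxE !eqxx scale1r.
rewrite big1 ?addr0 // => i ik.
by rewrite component_tensor mxE eqxx eq_sym (negbTE ik) scale0r.
Qed.

Lemma tensor_decomp m b : m \ox b = \sum_i e_ i \ox (m ord0 i *: b) :> T.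
Proof.
rewrite {1}(Cn_decomp m) (lin_sum (ptens_linl _ _)); apply: eq_bigr => i _.
by rewrite (linZ (ptens_linl _ _)) (linZ (ptens_linr _ _)).
Qed.

(** The algebraic tensor product with C^n is already complete. *)
Lemma component_decomp z : z = \sum_i e_ i \ox component i z :> T.
Proof.
apply/esym; move: z.
apply: (@tens_eq _ _ _ _ _ (fun z : T => \sum_i e_ i \ox component i z) id n%:R 1) => //.
- move=> k x y; rewrite scaler_sumr -big_split /=; apply: eq_bigr => i _.
  by rewrite component_lin ptens_linr.
- move=> x; apply: le_trans (ler_norm_sum _ _ _) _.
  rewrite mulr_natl -[X in _ *+ X](card_ord n) -sumr_const ler_sum // => i _.
  by rewrite ptens_cross Cn_basis_norm mul1r component_norm.
- by move=> x; rewrite mul1r.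
- by move=> a b; rewrite tensor_decomp; apply: eq_bigr => i _; rewrite component_sum.
Qed.

Lemma component_inj z z' : (forall i, component i z = component i z') -> z = z'.
Proof.
move=> h; rewrite (component_decomp z) (component_decomp z').
by apply: eq_bigr => i _; rewrite h.
Qed.

Lemma star_hom_of_coords (X : cstarType R) (h : 'I_n -> X -> B) :
  (forall i, star_hom (h i)) -> star_hom (fun x => \sum_i e_ i \ox h i x : T).
Proof.
move=> hh; split=> [k x y|x y|x]; apply: component_inj => i; have [hl hm hs] := hh i.
- by rewrite component_lin !component_sum hl.
- by have [_ cm _] := component_star_hom i; rewrite cm !component_sum hm.
- by have [_ _ cs] := component_star_hom i; rewrite cs !component_sum hs.
Qed.

End Coord.

End Coordinates.

(** * Square roots by iteration *)

Section Dyadic.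
Context (R : realType).

Lemma dyadic_small (e : R[i]) : 0 < e -> exists k, 2^-1 ^+ k < e.
Proof.
case: e => r s; rewrite ltcE /= => /andP[/eqP -> r0].
have [k rk] : exists k : nat, r^-1 < k%:R.
  by exists (Num.bound r^-1); rewrite archi_boundP // invr_ge0 ltW.
exists k; have -> : (2^-1 : R[i]) = (2^-1 : R)%:C%C.
  by rewrite fmorphV rmorph_nat.
rewrite -rmorphXn /= ltcR exprVn invf_plt ?posrE ?exprn_gt0 //.
by apply: lt_le_trans rk _; rewrite -natrX ler_nat ltnW // ltn_expl.
Qed.

Lemma dyadic_eq0 (a c : R[i]) : 0 <= a -> 0 <= c ->
  (forall k, a <= c * 2^-1 ^+ k) -> a = 0.
Proof.
move=> a0 c0 h; apply: (le_eps_eq0 a0 c0) => e /dyadic_small[k ke].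
by apply: le_trans (h k) _; rewrite ler_wpM2l // ltW.
Qed.

Lemma dyadic_limit (V : completeNormedModType R[i]) (y : nat -> V) :
  (forall k m, `|y (k + m)%N - y k| <= 2^-1 ^+ k.+1) ->
  exists l, forall k, `|l - y k| <= 2^-1 ^+ k.+1.
Proof.
move=> yc; have half1 : (2^-1 : R[i]) <= 1 by rewrite invf_le1 ?ler1n.
have : cvg (y @ \oo).
  apply: cauchy_cvg; apply: cauchy_exP => e /dyadic_small[k ke].
  exists (y k); exists k => // m /= km.
  rewrite -ball_normE /= distrC -(subnKC km); apply: le_lt_trans (yc _ _) _.
  by apply: le_lt_trans ke; rewrite exprS ger_pMl ?exprn_gt0 ?invr_gt0.
move=> /cvg_ex[l /cvgrPdist_lt yl]; exists l => k.
apply/ler_addgt0Pr => e /yl[N _ Ny].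
have := Ny (N + k)%N (leq_addr _ _) => /ltW le.
rewrite -(subrK (y (N + k)%N) l) -addrA; apply: le_trans (ler_normD _ _) _.
by rewrite [in leRHS]addrC lerD // addnC.
Qed.

Lemma dyadic_limit_eq0 (V W : normedModType R[i]) (y : nat -> V) l
    (h : V -> W) (c : R[i]) :
  (forall k, `|l - y k| <= 2^-1 ^+ k.+1) ->
  {morph h : x x' / x - x'} -> 0 <= c -> (forall x, `|h x| <= c * `|x|) ->
  (forall k, h (y k) = 0) -> h l = 0.
Proof.
move=> yl hB c0 hb hy; apply/eqP; rewrite -normr_eq0; apply/eqP.
apply: (@dyadic_eq0 _ (c * 2^-1)) => // [|k].
  by rewrite mulr_ge0 // invr_ge0.
have -> : h l = h (l - y k) by rewrite hB hy subr0.
by apply: le_trans (hb _) _; rewrite -mulrA -exprS ler_wpM2l.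
Qed.
End Dyadic.

Section SquareRoot.
Context (R : realType) (A : unitalCstarType R).
Implicit Types x y z : A.

Lemma cone_star : cstar (cone : A) = cone.
Proof. exact: cunit_star (cone_unit A). Qed.

Lemma cone_norm : `|cone : A| <= 1.
Proof. by apply: projection_norm_le1; rewrite ?cone_star ?cmul1l. Qed.

(** The root is c = 1 - l, where l solves 2 l = x + l^2.  The map
    y |-> (x + y^2) / 2 sends the ball of radius 1/2 to itself and halves
    distances there, so its iterates from 0 converge to l.  All iterates are
    self-adjoint and commute with whatever commutes with x, and both properties
    survive in the limit. *)
Lemma sqrt_one_sub x : cstar x = x -> `|x| <= 2^-1 ->
  exists c : A, [/\ cstar c = c, c ** c = cone - x
    & forall z, z ** x = x ** z -> z ** c = c ** z].
Proof.
move=> xs xn.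
have half2 : 2^-1 + 2^-1 = 1 :> R[i] by rewrite [RHS](splitr 1) mul1r.
pose g y : A := 2^-1 *: (x + y ** y).
have gl y z : `|y| <= 2^-1 -> `|z| <= 2^-1 -> `|g y - g z| <= 2^-1 * `|y - z|.
  move=> yn zn; rewrite /g -scalerBr normrZ ger0_norm ?invr_ge0 //.
  rewrite ler_wpM2l ?invr_ge0 // opprD addrACA subrr add0r.
  have -> : y ** y - z ** z = y ** (y - z) + (y - z) ** z.
    by rewrite cmulBr cmulBl addrA subrK.
  apply: le_trans (ler_normD _ _) _.
  apply: le_trans (lerD (cnormM _ _) (cnormM _ _)) _.
  rewrite [leLHS]addrC mulrC -mulrDl addrC -[leRHS]mul1r ler_wpM2r //.
  by rewrite [X in _ <= X](splitr 1) mul1r lerD.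
have gn y : `|y| <= 2^-1 -> `|g y| <= 2^-1.
  move=> yn; rewrite /g normrZ ger0_norm ?invr_ge0 // ger_pMr ?invr_gt0 //.
  apply: le_trans (ler_normD _ _) _; rewrite [X in _ <= X](splitr 1) mul1r.
  rewrite lerD //; apply: le_trans (cnormM _ _) _.
  apply: le_trans (ler_pM _ _ yn yn) _ => //.
  by rewrite ger_pMr ?invr_gt0 // invf_le1 ?ler1n.
pose y k := iter k g 0.
have yn k : `|y k| <= 2^-1.
  by elim: k => [|k]; [rewrite normr0 invr_ge0|exact: gn].
have [l ly] : exists l, forall k, `|l - y k| <= 2^-1 ^+ k.+1.
  apply: dyadic_limit; elim=> [|k IH] m; first by rewrite subr0 expr1.
  rewrite addSn /= exprS; apply: le_trans (gl _ _ _ _) _ => //.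
  by rewrite ler_wpM2l ?invr_ge0.
have ln : `|l| <= 2^-1 by have := ly 0%N; rewrite subr0 expr1.
have lg : l = g l.
  apply/eqP; rewrite -subr_eq0 -normr_eq0; apply/eqP.
  apply: (@dyadic_eq0 _ _ 1) => // k; rewrite mul1r.
  rewrite -(subrK (y k.+1) l) -addrA -/(g _) subrK.
  apply: le_trans (ler_normD _ _) _.
  have h : 2^-1 ^+ k.+2 + 2^-1 * 2^-1 ^+ k.+1 <= 2^-1 ^+ k :> R[i].
    rewrite -exprS [2^-1 ^+ k.+2]exprS -mulrDl half2 mul1r.
    by rewrite exprS ger_pMl ?exprn_gt0 ?invr_gt0 // invf_le1 ?ler1n.
  apply: le_trans h; rewrite lerD //.
  by apply: le_trans (gl _ _ _ _) _ => //; rewrite distrC ler_wpM2l ?invr_ge0.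
have ls : cstar l = l.
  apply/eqP; rewrite -subr_eq0; apply/eqP.
  apply: (dyadic_limit_eq0 (h := fun y => cstar y - y) (c := 2) ly) => //.
  - by move=> u v /=; rewrite cstarB opprD addrACA -opprD.
  - move=> u; apply: le_trans (ler_normB _ _) _.
    by rewrite cnorm_cstar mulr_natl mulr2n.
  - elim=> [|k /eqP]; first by rewrite cstar0 subr0.
    rewrite subr_eq0 => /eqP IH; rewrite /= /g cstarZ cstarD cstarM IH xs.
    by rewrite fmorphV rmorph_nat subrr.
have lc z : z ** x = x ** z -> z ** l = l ** z.
  move=> zx; apply/eqP; rewrite -subr_eq0; apply/eqP.
  apply: (dyadic_limit_eq0 (h := fun y => z ** y - y ** z) (c := 2 * `|z|) ly) => //.
  - by move=> u v /=; rewrite cmulBr cmulBl opprD addrACA -opprD.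
  - by rewrite mulr_ge0.
  - move=> u; apply: le_trans (ler_normB _ _) _.
    apply: le_trans (lerD (cnormM _ _) (cnormM _ _)) _.
    by rewrite [`|u| * _]mulrC -mulrA mulr_natl mulr2n.
  - elim=> [|k /eqP]; first by rewrite /= cmul0r cmul0l subr0.
    rewrite subr_eq0 => /eqP IH; rewrite /= /g cmulZr cmulZl cmulDr cmulDl zx.
    by rewrite cmulA IH -cmulA IH cmulA subrr.
exists (cone - l); split.
- by rewrite cstarB cone_star ls.
- have : l + l = x + l ** l.
    by rewrite {1 2}lg /g -scalerDl half2 scale1r.
  move=> /(canLR (addrK _)) xE; rewrite -xE cmulBr !cmulBl cmul1l cmul1r cmul1l.
  by rewrite -addrA !opprB; congr (_ + _); rewrite opprD addrCA.
- by move=> z /lc zl; rewrite cmulBr cmulBl zl cmul1l cmul1r.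
Qed.

End SquareRoot.

(** * Kernels of unital star-homomorphisms are closed *)

Section UnitarySum.
Context (R : realType) (B : cstarType R).
Implicit Types x y : B.

(** With u = x + i y one has u^* u = x^2 + y^2, while x is the real part of u and
    so |x| <= |u|. *)
Lemma cnorm_sum_squares x y : cstar x = x -> cstar y = y -> x ** y = y ** x ->
  `|x ** x| <= `|x ** x + y ** y|.
Proof.
move=> xs ys xy; pose u := x + 'i *: y.
have us : cstar u = x - 'i *: y.
  by rewrite cstarD cstarZ xs ys conjCi scaleNr.
have uu : cstar u ** u = x ** x + y ** y.
  rewrite us cmulDr !cmulBl !(cmulZl, cmulZr) scalerA -expr2 sqrCi scaleN1r.
  by rewrite opprK xy addrA subrK.
have xn : `|x| <= `|u|.
  have xE : x = 2^-1 *: (u + cstar u).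
    rewrite us addrACA subrr addr0 -mulr2n -[x *+ 2]scaler_nat scalerA.
    by rewrite mulVf ?pnatr_eq0 // scale1r.
  rewrite {1}xE normrZ ger0_norm ?invr_ge0 // ler_pdivrMl //.
  by apply: le_trans (ler_normD _ _) _; rewrite cnorm_cstar mulr_natl mulr2n.
by rewrite -uu cnorm_star cnorm_sa // lerXn2r ?nnegrE.
Qed.
End UnitarySum.

Section Boundedness.
Context (R : realType) (A B : unitalCstarType R) (f : A -> B).
Hypothesis fu : unital_star_hom f.

(** Let c be a square root of 1 - h^2.  The images of h and c commute and the sum
    of their squares is 1, so the image of h has norm at most 1: it is the real
    part of a unitary. *)
Lemma unital_star_hom_half h : cstar h = h -> `|h| <= 2^-1 -> `|f h| <= 1.
Proof.
have [[fl fm fs] f1] := fu; move=> hs hn.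
have [||c [cs cc cz]] := @sqrt_one_sub R A (h ** h).
- by rewrite cstarM hs.
- apply: le_trans (cnormM _ _) _; apply: le_trans (ler_pM _ _ hn hn) _ => //.
  by rewrite ger_pMr ?invr_gt0 // invf_le1 ?ler1n.
have hc : f h ** f c = f c ** f h by rewrite -!fm cz // cmulA.
have := cnorm_sum_squares _ _ hc; rewrite -!fs hs cs => /(_ erefl erefl).
rewrite -!fm cc -(linD fl) addrC subrK f1 fm cnorm_sa -?fs ?hs // => le.
by have := le_trans le (cone_norm B); rewrite expr_le1.
Qed.

(** Scaling z^* z to norm 1/2 reduces to the self-adjoint case.  The constant 2 is
    not optimal; any bound makes the kernel closed. *)
Lemma unital_star_hom_bounded z : `|f z| <= 2 * `|z|.
Proof.
have [[fl fm fs] f1] := fu.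
have [->|z0] := eqVneq z 0; first by rewrite (lin0 fl) !normr0 mulr0.
have zp : 0 < 2 * `|z| ^+ 2 by rewrite mulr_gt0 // exprn_gt0 // normr_gt0.
set k := 2 * `|z| ^+ 2 in zp; have kp : 0 < k^-1 by rewrite invr_gt0.
have kr : `|k^-1| = k^-1 by rewrite gtr0_norm.
pose h := k^-1 *: (cstar z ** z).
have hs : cstar h = h.
  rewrite cstarZ cstarM cstarK conj_Creal //; exact: gtr0_real.
have hn : `|h| <= 2^-1.
  rewrite normrZ kr cnorm_star /k invfM -mulrA mulVf ?mulr1 //.
  by rewrite expf_neq0 // normr_eq0.
have := unital_star_hom_half hs hn.
rewrite (linZ fl) normrZ kr fm fs cnorm_star ler_pdivrMl // mulr1 => le.
rewrite -ler_sqr ?nnegrE ?mulr_ge0 //; apply: le_trans le _.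
by rewrite exprMn ler_wpM2r ?exprn_ge0 // expr2 ler_peMl // ler1n.
Qed.

Lemma unital_star_hom_ker_closed : closed [set x | f x = 0].
Proof.
have [[fl _ _] _] := fu.
move=> x xc; apply/eqP; rewrite -normr_eq0; apply/eqP.
apply: (@le_eps_eq0 _ _ 2) => // e e0.
have [y /= y0 xy] := closure_approx xc e0.
rewrite -[f x]subr0 -y0 -(linB fl); apply: le_trans (unital_star_hom_bounded _) _.
by rewrite ler_wpM2l // ltW.
Qed.

End Boundedness.

(** * Projections with sum 1 are orthogonal *)

Section Projections.
Context (R : realType) (B : unitalCstarType R).
Implicit Types q w : B.

Section Corner.
Variable q : B.
Hypotheses (qs : cstar q = q) (qq : q ** q = q).

(** From (2 w)^2 + (q - w^2)^2 = (q + w^2)^2, where the summands on the left are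
    squares of commuting self-adjoint elements. *)
Lemma corner_norm w : cstar w = w -> q ** w = w -> `|q + w ** w| <= 1 ->
  4 * `|w ** w| <= 1.
Proof.
move=> ws qw le; have wq : w ** q = w by rewrite -[LHS]cstarK cstarM ws qs qw.
set v := w ** w in le *.
have vs : cstar v = v by rewrite cstarM ws.
have qv : q ** v = v by rewrite cmulA qw.
have vq : v ** q = v by rewrite -cmulA wq.
have := @cnorm_sum_squares _ _ (2 *: w) (q - v) _ _ _.
rewrite cstarZ ws rmorph_nat cstarB qs vs => /(_ erefl erefl).
rewrite cmulZl cmulBr wq cmulZr cmulBl qw {1 2}/v cmulA => /(_ erefl).
rewrite cmulZl cmulZr scalerA -/v normrZ ger0_norm ?mulr_ge0 // -natrM.
move=> /le_trans; apply.
have -> : 4%:R *: v + (q - v) ** (q - v) = (q + v) ** (q + v).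
  have aux u : v + v + (u - v) = u + v by rewrite addrC addrA subrK.
  have -> : 4 *: v = (v + v) + (v + v).
    by rewrite scaler_nat -[4%N]/(2 + 2)%N mulrnDr mulr2n.
  rewrite cmulBr !cmulBl cmulDr !cmulDl qq qv vq opprB addrACA !aux.
  by rewrite [v ** v + v]addrC.
apply: le_trans (cnormM _ _) _.
by rewrite -[leRHS]mulr1 ler_pM.
Qed.

(** By [corner_norm] the element 2 w^2 is small, so 1 + 2 w^2 has a square root c.
    Then q c is a square root of q + 2 w^2, and
    (q c)^2 + (w^2)^2 = (q + w^2)^2 bounds |(q c)^2|. *)
Lemma corner_double w : cstar w = w -> q ** w = w -> `|q + w ** w| <= 1 ->
  `|q + 2 *: (w ** w)| <= 1.
Proof.
move=> ws qw le; have wq : w ** q = w by rewrite -[LHS]cstarK cstarM ws qs qw.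
have vn := corner_norm ws qw le; set v := w ** w in le vn *.
have vs : cstar v = v by rewrite cstarM ws.
have qv : q ** v = v by rewrite cmulA qw.
have vq : v ** q = v by rewrite -cmulA wq.
have [||c [cs cc cz]] := @sqrt_one_sub R B (- (2 *: v)).
- by rewrite cstarN cstarZ vs rmorph_nat.
- rewrite normrN normrZ ger0_norm // -(ler_pM2l (x := 2)) //.
  by rewrite [leRHS]mulfV ?pnatr_eq0 // mulrA -natrM.
rewrite opprK in cc.
have qc : q ** c = c ** q by apply: cz; rewrite cmulNl cmulNr cmulZl cmulZr qv vq.
have vc : v ** c = c ** v by apply: cz; rewrite cmulNl cmulNr cmulZl cmulZr.
have zz : q ** c ** (q ** c) = q + 2 *: v.
  by rewrite {2}qc cmulA -(cmulA q) cc cmulDr cmulDl cmul1r cmulZr cmulZl qv vq qq.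
have := @cnorm_sum_squares _ _ (q ** c) v _ vs _.
rewrite cstarM cs qs qc => /(_ erefl).
rewrite -qc cmulA vq -cmulA -vc cmulA qv vc => /(_ erefl).
rewrite zz => /le_trans; apply.
have -> : q + 2 *: v + v ** v = (q + v) ** (q + v).
  by rewrite cmulDr !cmulDl qq qv vq scaler_nat mulr2n !addrA.
apply: le_trans (cnormM _ _) _.
by rewrite -[leRHS]mulr1 ler_pM.
Qed.

(** In the corner with unit q, w^2 >= 0, so q + w^2 can have norm at most 1 only if
    w = 0.  Doubling w^2 repeatedly keeps the hypothesis, while [corner_norm] keeps
    the multiples 2^k w^2 bounded. *)
Lemma corner_square_eq0 w : cstar w = w -> q ** w = w ->
  `|q + w ** w| <= 1 -> w = 0.
Proof.
move=> ws qw le; apply: cstar_mul_eq0; rewrite ws.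
apply/eqP; rewrite -normr_eq0; apply/eqP.
apply: (@dyadic_eq0 _ _ 1) => // k; rewrite mul1r.
rewrite exprVn -[leRHS]mul1r ler_pdivlMr ?exprn_gt0 //.
have h1 : forall w', cstar w' = w' -> q ** w' = w' -> `|q + w' ** w'| <= 1 ->
    `|w' ** w'| * 2 ^+ k <= 1.
  elim: k => [|k IH] w' ws' qw' le'.
    rewrite expr0 mulr1; apply: le_trans (corner_norm ws' qw' le').
    by rewrite ler_peMl // ler1n.
  (* replacing w' by sqrt(2) w' doubles the square *)
  have r2 : sqrtC 2 * sqrtC 2 = 2 :> R[i] by rewrite -expr2 sqrtCK.
  have E : (sqrtC 2 *: w') ** (sqrtC 2 *: w') = 2 *: (w' ** w').
    by rewrite cmulZl cmulZr scalerA r2.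
  have := IH (sqrtC 2 *: w'); rewrite E normrZ ger0_norm // exprS.
  rewrite mulrA [2 * _]mulrC -!mulrA; apply.
  - rewrite cstarZ ws' conj_Creal // ger0_real // sqrtC_ge0 //.
  - by rewrite cmulZr qw'.
  - exact: corner_double.
exact: h1.
Qed.
End Corner.

(** Write q = p_j, r = p_i and y = q r q = (r q)^* (r q).  Compressing the relation
    sum_k p_k = 1 by q expresses -y as the sum of the positive elements q p_k q for
    k other than i and j.  So, with N the number of projections, both N q + y and
    N q - y are sums of N elements of norm at most 1.  With z = y / N this gives
    |q + z| <= 1 and |q - z| <= 1, and q + z^2 is half the sum of (q + z)^2 and
    (q - z)^2, so z = 0. *)
Lemma projections_orthogonal (I : finType) (p : I -> B) :
  (forall i, cstar (p i) = p i) -> (forall i, p i ** p i = p i) ->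
  \sum_i p i = cone -> forall i j, i != j -> p i ** p j = 0.
Proof.
move=> ps pp p1 i j ij; set q := p j; set r := p i.
pose y := q ** r ** q; pose N : R[i] := #|I|%:R.
have Np : 0 < N by rewrite ltr0n; apply/card_gt0P; exists i.
have qn : `|q| <= 1 by exact: (projection_norm_le1 (ps j) (pp j)).
have ys : cstar y = y by rewrite /y !cstarM !ps cmulA.
have qy : q ** y = y by rewrite /y !cmulA pp.
have yq : y ** q = y by rewrite /y -!cmulA pp.
have compl k : `|q - q ** p k ** q| <= 1.
  have -> : q - q ** p k ** q = q ** (cone - p k) ** q.
    by rewrite cmulBr cmulBl cmul1r pp.
  have c1 : `|cone - p k| <= 1.
    apply: projection_norm_le1; first by rewrite cstarB cone_star ps.
    by rewrite cmulBr !cmulBl !(cmul1r, cmul1l) pp subrr subr0.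
  apply: le_trans (cnormM _ _) _; rewrite -[leRHS]mulr1 ler_pM //.
  by apply: le_trans (cnormM _ _) _; rewrite -[leRHS]mulr1 ler_pM.
have sumN (F : I -> B) : (forall k, `|F k| <= 1) -> `|\sum_k F k| <= N.
  move=> F1; apply: le_trans (ler_norm_sum _ _ _) _.
  by rewrite /N -sumr_const ler_sum // => k _; exact: F1.
have qsum : \sum_k q ** p k ** q = q.
  by rewrite -cmul_suml -cmul_sumr p1 cmul1r pp.
have le1 : `|N *: q + y| <= N.
  pose F k := if (k == i) || (k == j) then q else q - q ** p k ** q.
  have -> : N *: q + y = \sum_k F k.
    pose G k := if (k != i) && (k != j) then q ** p k ** q else 0.
    have FE k : F k = q - G k.
      by rewrite /F /G -negb_or; case: ifP => _; rewrite ?subr0.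
    rewrite (eq_bigr _ (fun k _ => FE k)) sumrB sumr_const /N scaler_nat.
    congr (_ + _); rewrite -big_mkcond /=.
    have := qsum; rewrite (bigD1 i) //= (bigD1 j) 1?eq_sym //= !pp -/r -/y.
    move=> /(canRL (addKr _)); rewrite addrC.
    by move=> /(canRL (addrK _)) ->; rewrite opprB addrC opprD opprK subrK.
  by apply: sumN => k; rewrite /F; case: ifP.
have le2 : `|N *: q - y| <= N.
  pose F k := if k == i then q - y else q.
  have -> : N *: q - y = \sum_k F k.
    have FE k : F k = q - (if k == i then y else 0).
      by rewrite /F; case: ifP => _; rewrite ?subr0.
    rewrite (eq_bigr _ (fun k _ => FE k)) sumrB sumr_const /N scaler_nat.
    by rewrite -big_mkcond big_pred1_eq.
  by apply: sumN => k; rewrite /F; case: ifP => // _; exact: compl.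
pose z := N^-1 *: y.
have Nn : `|N^-1| = N^-1 by rewrite gtr0_norm // invr_gt0.
have scale w : `|N *: w| <= N -> `|w| <= 1.
  by rewrite normrZ gtr0_norm // -[leRHS]mulr1 ler_pM2l.
have Nz : N *: z = y by rewrite scalerA mulfV ?scale1r // gt_eqF.
have le1' : `|q + z| <= 1 by apply: scale; rewrite scalerDr Nz.
have le2' : `|q - z| <= 1 by apply: scale; rewrite scalerBr Nz.
have zs : cstar z = z.
  by rewrite cstarZ ys conj_Creal // ger0_real // invr_ge0 ltW.
have qz : q ** z = z by rewrite cmulZr qy.
have zq : z ** q = z by rewrite cmulZl yq.
have z0 : z = 0.
  apply: (corner_square_eq0 (ps j) (pp j) zs qz).
  have -> : q + z ** z = 2^-1 *: ((q + z) ** (q + z) + (q - z) ** (q - z)).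
    have aux (u w : B) : u + w + (u - w) = u + u.
      by rewrite addrACA subrr addr0.
    rewrite !(cmulDl, cmulDr, cmulNl, cmulNr) pp qz zq opprB addrACA aux.
    rewrite [z + z ** z]addrC aux addrACA scalerDr -scalerDl.
    by rewrite -[2^-1]mul1r -splitr scale1r.
  rewrite normrZ ger0_norm ?invr_ge0 // ler_pdivrMl // mulr1.
  apply: le_trans (ler_normD _ _) _; rewrite mulr2n lerD //.
  - by apply: le_trans (cnormM _ _) _; rewrite -[leRHS]mulr1 ler_pM.
  - by apply: le_trans (cnormM _ _) _; rewrite -[leRHS]mulr1 ler_pM.
apply: cstar_mul_eq0; rewrite cstarM !ps cmulA -(cmulA q) pp -/y.
by rewrite -Nz z0 scaler0.
Qed.

End Projections.

(** * Actions on C^n and their matrices *)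

Lemma bounded_continuous (R : realType) (V W : normedModType R[i]) (f : V -> W)
    (c : R[i]) :
  linear f -> 0 < c -> (forall x, `|f x| <= c * `|x|) -> continuous f.
Proof.
move=> fl c0 fb x; apply/cvgrPdist_lt => e e0.
have ec : 0 < e / c by rewrite divr_gt0.
apply: filterS (nbhsx_ballx x _ ec) => y; rewrite -ball_normE /= => xy.
by rewrite -(linB fl); apply: le_lt_trans (fb _) _; rewrite mulrC -ltr_pdivlMr.
Qed.

Lemma lin_basis_eq (R : realType) (n : nat) (W : lmodType R[i])
    (f g : Cn R n -> W) :
  linear f -> linear g -> (forall j, f (Cn_basis R j) = g (Cn_basis R j)) ->
  f =1 g.
Proof.
move=> fl gl fg m; rewrite (Cn_decomp m) (lin_sum fl) (lin_sum gl).
by apply: eq_bigr => j _; rewrite (linZ fl) (linZ gl) fg.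
Qed.

Section UnitalTensor.
Context (R : realType).

(** Packing over the class of B, rather than over B itself, keeps the carrier and
    all operations definitionally those of B. *)
Definition unital_of (B : cstarType R) (e : B) (eu : cunit e) :
    unitalCstarType R :=
  let c := CStar.class B in
  let f := CStar_isUnital.Build R (CStar.Pack c) eu.1 eu.2 in
  HB.pack (CStar.sort B) c f.

Lemma tens_one (A B : unitalCstarType R) (T : minTensor A B) :
  cunit (cone \ox cone : T).
Proof. by apply: cunit_tensor; exact: cone_unit. Qed.
End UnitalTensor.

Section Magic.
Context (R : realType) (n : nat).

Lemma magic_image (A B : unitalCstarType R) (a : 'I_n -> 'I_n -> A) (f : A -> B) :
  unital_star_hom f -> magic_relations a ->
  magic_relations (fun i j => f (a i j)).
Proof.
move=> [[fl fm fs] f1] [aa as_ ar ac]; split=> [i j|i j|i|j].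
- by rewrite -fm aa.
- by rewrite -fs as_.
- by rewrite -(lin_sum fl) ar.
- by rewrite -(lin_sum fl) ac.
Qed.

(** Multiplicativity is the orthogonality of the projections in a row. *)
Lemma magic_row_star_hom (A : unitalCstarType R) (a : 'I_n -> 'I_n -> A) i :
  magic_relations a ->
  star_hom (fun m : Cn R n => \sum_j m ord0 j *: a i j).
Proof.
move=> [aa as_ ar _].
have orth := projections_orthogonal (as_ i) (aa i) (ar i).
split=> [k x y|x y|x].
- rewrite scaler_sumr -big_split /=; apply: eq_bigr => j _.
  by rewrite !mxE scalerDl scalerA.
- rewrite cmul_suml; apply: eq_bigr => j _; rewrite cmul_sumr (bigD1 j) //=.
  rewrite big1 ?addr0 => [|k kj].
    by rewrite cmulZl cmulZr aa scalerA mxE.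
  by rewrite cmulZl cmulZr orth ?scaler0 // eq_sym.
- rewrite cstar_sum; apply: eq_bigr => j _.
  by rewrite cstarZ as_ mxE.
Qed.
End Magic.

Section FamiliesOfMaps.
Context (R : realType) (tp : minTensorProduct R) (n : nat).
Local Notation M := (Cn R n).
Local Notation e_ := (@Cn_basis R n).

Section OneFamily.
Context (B : unitalCstarType R) (Phi : M -> tp M B -> tp M B).
Hypothesis PhiM : Mor Phi.

(** For m = e_j this is the matrix coefficient u_ij of Phi; at general m it is the
    i-th row of the matrix applied to m, and it is a star-homomorphism in m. *)
Definition entry (i : 'I_n) (m : M) : B := component i (Phi m (cone \ox cone)).

Lemma entry_star_hom i : star_hom (entry i).
Proof.
apply: star_hom_comp (component_star_hom _ i).
exact: Mor_star_hom (tens_one _) PhiM.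
Qed.

Lemma entry_one i : entry i cone = cone.
Proof.
rewrite /entry (Mor_unit (tens_one _) PhiM (cone_unit _)) component_tensor.
by rewrite mxE scale1r.
Qed.

Lemma family_entries j x : Phi (e_ j) x = (\sum_i e_ i \ox entry i (e_ j)) ** x.
Proof. by rewrite -component_decomp -(Mor_mul (tens_one _) PhiM). Qed.
End OneFamily.

Section Composition.
Context (B C : unitalCstarType R).
Context (Phi : M -> tp M B -> tp M B) (Psi : M -> tp M C -> tp M C).

(** The relation Psi = (id (x) Lambda) o Phi, evaluated at the unit and read in the
    i-th component. *)
Lemma entry_comp (Lambda : B -> C -> C) (K : tp M B -> tp M C -> tp M C) i m :
  Mor Lambda -> is_tensor_mor (@id_mor R M) Lambda K -> is_comp K Phi Psi ->
  entry Psi i m = Lambda (entry Phi i m) cone.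
Proof.
move=> LM [[_ Kl _ _ _] Kt] Kc; rewrite /entry.
have [_ /(_ (cone \ox cone) (cone \ox cone))] := Kc m.
rewrite Kt /id_mor /to_mult cmul1l (Mor_unit (cone_unit _) LM (cone_unit _)).
move=> ->; rewrite {1}(component_decomp (Phi m _)).
have K1 : linear (fun z => K z (cone \ox cone)) by move=> k x y; exact: Kl.
rewrite (lin_sum K1).
under eq_bigr do rewrite Kt /id_mor /to_mult cmul1r.
by rewrite component_sum.
Qed.

(** Converse of [entry_comp]: on C^n (x) B the morphism id (x) g is g applied in
    each component. *)
Lemma amplification (g : B -> C) :
  unital_star_hom g -> Mor Phi -> Mor Psi ->
  (forall i m, entry Psi i m = g (entry Phi i m)) ->
  exists K : tp M B -> tp M C -> tp M C,
    is_tensor_mor (@id_mor R M) (to_mult g) K /\ is_comp K Phi Psi.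
Proof.
move=> [gh g1] PhiM PsiM PP; have [gl _ _] := gh.
pose G (z : tp M B) : tp M C := \sum_i e_ i \ox g (component i z).
have Gh : star_hom G.
  by apply: star_hom_of_coords => i; exact: star_hom_comp (component_star_hom _ i) gh.
have [_ Gm _] := Gh.
have Gt m b : G (m \ox b) = m \ox g b.
  rewrite [RHS]tensor_decomp; apply: eq_bigr => i _.
  by rewrite component_tensor (linZ gl).
have PsiG m : Psi m (cone \ox cone) = G (Phi m (cone \ox cone)).
  by apply: component_inj => i; rewrite component_sum; exact: PP.
exists (to_mult G); split; first split.
- apply: (@to_mult_Mor _ _ _ (cone \ox cone)) (tens_one _) Gh _.
  by rewrite Gt g1.
- by move=> m m' b b'; rewrite /to_mult Gt ptensM.
- move=> m; split; first by case: PsiM.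
  move=> b c; rewrite (Mor_mul (tens_one _) PsiM) PsiG /to_mult.
  by rewrite cmulA -Gm -(Mor_mul (tens_one _) PhiM).
Qed.
End Composition.

Lemma slice_coords (B : unitalCstarType R) (omega : M -> R[i])
    (sigma : tp M B -> B) z :
  is_slice omega sigma -> sigma z = \sum_i omega (e_ i) *: component i z.
Proof.
move=> [sl _ st]; rewrite {1}(component_decomp z) (lin_sum sl).
by apply: eq_bigr => i _; rewrite st.
Qed.

Lemma unif_state_basis j : unif_state (e_ j) = n%:R^-1.
Proof.
rewrite /unif_state (bigD1 j) //= mxE !eqxx mulr1 big1 ?addr0 // => i ij.
by rewrite mxE eqxx (negbTE ij) mulr0.
Qed.

(** The ideal that defines the measure preserving quotient is generated by values
    of slice maps; without the existence of one it could be zero. *)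
Lemma unif_slice (B : unitalCstarType R) :
  exists sigma : tp M B -> B, is_slice (@unif_state R n) sigma.
Proof.
pose sigma (z : tp M B) : B := \sum_i n%:R^-1 *: component i z.
have sl : linear sigma.
  move=> k x y; rewrite scaler_sumr -big_split /=; apply: eq_bigr => i _.
  by rewrite component_lin scalerDr !scalerA mulrC.
exists sigma; split=> //.
  apply: (@bounded_continuous _ _ _ _ (\sum_(i < n) `|n%:R^-1| + 1)) => //.
    by rewrite ltr_wpDl // sumr_ge0.
  move=> z; apply: le_trans (ler_norm_sum _ _ _) _.
  rewrite mulrDl mul1r; apply: ler_wpDr => //; rewrite mulr_suml ler_sum // => i _.
  by rewrite normrZ ler_wpM2l // component_norm.
move=> m b; rewrite /sigma /unif_state scaler_suml; apply: eq_bigr => i _.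
by rewrite component_tensor scalerA.
Qed.

(** Evaluated at e_j and at the unit, the left side of the coaction identity is
    sum_k sum_i (e_i (x) u_ik) (x) u_kj and the right side is
    sum_i e_i (x) Delta(u_ij). *)
Lemma comult_entries (B : unitalCstarType R) (Phi : M -> tp M B -> tp M B)
    (Delta : B -> tp B B -> tp B B) i j :
  Mor Phi -> Mor Delta -> comult_eq Phi Delta ->
  Delta (entry Phi i (e_ j)) (cone \ox cone) =
  \sum_k entry Phi i (e_ k) \ox entry Phi k (e_ j).
Proof.
move=> PhiM DM [alpha [K1 [K2 [L1 [L2 [[[al am as_] ab at_]]]]]]].
move=> [[[_ K1l _ _ _] K1t] [L1c [[[_ K2l _ _ _] K2t] [L2c LL]]]].
have P1 := Mor_unit (tens_one _) PhiM (cone_unit _).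
have D1 := Mor_unit (tens_one _) DM (cone_unit _).
have Pj l : Phi (e_ l) (cone \ox cone) = \sum_i e_ i \ox entry Phi i (e_ l).
  exact: component_decomp.
have L1j : L1 (e_ j) (cone \ox cone \ox cone) =
    \sum_k \sum_i (e_ i \ox entry Phi i (e_ k) : tp M B) \ox entry Phi k (e_ j).
  have [_ /(_ (cone \ox cone) (cone \ox cone \ox cone))] := L1c (e_ j).
  rewrite K1t P1 /id_mor /to_mult cmul1l => ->.
  have K1' : linear (fun z => K1 z (cone \ox cone \ox cone)).
    by move=> k x y; exact: K1l.
  rewrite Pj (lin_sum K1'); apply: eq_bigr => k _.
  by rewrite K1t /id_mor /to_mult cmul1r Pj (lin_sum (ptens_linl _ _)).
have L2j : L2 (e_ j) (cone \ox (cone \ox cone)) =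
    \sum_i e_ i \ox Delta (entry Phi i (e_ j)) (cone \ox cone).
  have [_ /(_ (cone \ox cone) (cone \ox (cone \ox cone)))] := L2c (e_ j).
  rewrite K2t D1 /id_mor /to_mult cmul1l => ->.
  have K2' : linear (fun z => K2 z (cone \ox (cone \ox cone))).
    by move=> k x y; exact: K2l.
  rewrite Pj (lin_sum K2'); apply: eq_bigr => k _.
  by rewrite K2t /id_mor /to_mult cmul1r.
have := LL (e_ j) (cone \ox cone \ox cone); rewrite at_ L2j L1j exchange_big /=.
move=> /(congr1 (component i)); rewrite component_sum => <-.
rewrite (lin_sum al) -[RHS](@component_sum _ _ _ (tp M (tp B B)) i
  (fun i => \sum_k entry Phi i (e_ k) \ox entry Phi k (e_ j))).
congr component; apply: eq_bigr => l _; rewrite (lin_sum al) (lin_sum (ptens_linr _ _)).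
by apply: eq_bigr => k _; rewrite at_.
Qed.

End FamiliesOfMaps.

(** * Quotients, and the universal property of Aut(X_n) *)

Section MorphismValues.
Context (R : realType) (A B : unitalCstarType R).

Lemma Mor_at_one (Lambda : A -> B -> B) :
  Mor Lambda -> unital_star_hom (Lambda^~ cone).
Proof.
move=> LM; split; first exact: Mor_star_hom (cone_unit _) LM.
exact: (Mor_unit (cone_unit _) LM (cone_unit _)).
Qed.

Lemma unital_Mor (f : A -> B) : unital_star_hom f -> Mor (to_mult f).
Proof. by move=> [fh f1]; exact: to_mult_Mor (cone_unit _) fh f1. Qed.

Lemma unital_star_hom_ker_ideal (f : A -> B) :
  unital_star_hom f -> closed_ideal [set x | f x = 0].
Proof.
move=> fu; have [[fl fm fs] f1] := fu; split=> [|k x y|a x|a x|] /=.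
- exact: lin0 fl.
- by move=> x0 y0; rewrite fl x0 y0 scaler0 addr0.
- by move=> x0; rewrite fm x0 cmul0r.
- by move=> x0; rewrite fm x0 cmul0l.
- exact: unital_star_hom_ker_closed.
Qed.

Lemma quotient_unital (J : set A) (q : A -> B) :
  is_quotient J q -> unital_star_hom q.
Proof.
move=> [qh qs _ _ _]; split=> //; have [_ qm _] := qh.
by have [x qx] := qs cone; rewrite -[LHS]cmul1r -qx -qm cmul1l.
Qed.

Lemma unital_star_hom_comp (C : unitalCstarType R) (f : A -> B) (g : B -> C) :
  unital_star_hom f -> unital_star_hom g -> unital_star_hom (g \o f).
Proof.
by move=> [fh f1] [gh g1]; split; [exact: star_hom_comp|rewrite /= f1 g1].
Qed.

Lemma quotient_lift (C : unitalCstarType R) (J : set A) (q : A -> B) (f : A -> C) :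
  is_quotient J q -> unital_star_hom f -> (forall x, J x -> f x = 0) ->
  exists g : B -> C, unital_star_hom g /\ forall x, g (q x) = f x.
Proof.
move=> Jq [[fl fm fs] f1] fJ.
have [[ql qm qs] q1] := quotient_unital Jq.
have [_ qsurj qker _ _] := Jq.
have [s sK] := choice qsurj.
have fq x y : q x = q y -> f x = f y.
  move=> qxy; apply/eqP; rewrite -subr_eq0 -(linB fl); apply/eqP.
  by apply/fJ/qker; rewrite (linB ql) qxy subrr.
have gq x : f (s (q x)) = f x by apply: fq; rewrite sK.
exists (f \o s); split=> //; split=> [|/=]; last by rewrite -q1 gq f1.
split=> [k x y|x y|x] /=.
- by rewrite -fl; apply: fq; rewrite ql !sK.
- by rewrite -fm; apply: fq; rewrite qm !sK.
- by rewrite -fs; apply: fq; rewrite qs !sK.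
Qed.

End MorphismValues.

Section UniversalMagic.
Context (R : realType) (tp : minTensorProduct R) (n : nat).
Context (A : unitalCstarType R) (a : 'I_n -> 'I_n -> A) (Delta : A -> tp A A -> tp A A).
Hypothesis hAut : is_Aut a Delta.

Lemma Aut_ext (B : unitalCstarType R) (f g : A -> B) :
  unital_star_hom f -> unital_star_hom g ->
  (forall i j, f (a i j) = g (a i j)) -> f =1 g.
Proof.
move=> fu gu fg; have [am univ _ _] := hAut.
have [h [_ hu]] := univ _ _ (magic_image fu am).
have <- : h = f by apply: hu.
by have <- : h = g by apply: hu; split=> // i j; rewrite fg.
Qed.

(** The universal property speaks of unital algebras, so T is first given its unit
    1 (x) 1. *)
Lemma Aut_tensor_ext (B C : unitalCstarType R) (T : minTensor B C) (f g : A -> T) :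
  star_hom f -> star_hom g ->
  f cone = cone \ox cone -> g cone = cone \ox cone ->
  (forall i j, f (a i j) = g (a i j)) -> f =1 g.
Proof.
move=> fh gh f1 g1.
by apply: (@Aut_ext (unital_of (tens_one T)) f g); split.
Qed.

End UniversalMagic.

(** * The measure preserving quotient *)

Section Comparison.
Context (R : realType) (tp : minTensorProduct R) (n : nat).
Local Notation M := (Cn R n).
Local Notation e_ := (@Cn_basis R n).

Section Preserving.
Context (At Ad : unitalCstarType R).
Context (Phit : M -> tp M At -> tp M At) (Phi : M -> tp M Ad -> tp M Ad).
Context (q : At -> Ad).
Hypothesis PhitM : Mor Phit.
Hypothesis quot :
  is_quotient (smallest (@closed_ideal R At)
                        (preserving_gens (@unif_state R n) Phit)) q.
Hypothesis PhiM : Mor Phi.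
Hypothesis q_comp : exists K : tp M At -> tp M Ad -> tp M Ad,
  is_tensor_mor (@id_mor R M) (to_mult q) K /\ is_comp K Phit Phi.

Lemma entry_quotient i m : entry Phi i m = q (entry Phit i m).
Proof.
have [K [KT Kc]] := q_comp.
rewrite (entry_comp i m (unital_Mor (quotient_unital quot)) KT Kc).
by rewrite /to_mult cmul1r.
Qed.

(** The rows have sum 1 because Phi is unital.  The columns have sum 1 because
    (1/n) (sum_i u_ij - 1) is a generator of the ideal that q kills. *)
Lemma entries_magic : (0 < n)%N -> magic_relations (fun i j => entry Phi i (e_ j)).
Proof.
move=> n_gt0; have [[ql qm qs] q1] := quotient_unital quot.
have bb j : e_ j ** e_ j = e_ j by rewrite Cn_basisM mxE !eqxx scale1r.
split=> [i j|i j|i|j].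
- by have [_ hm _] := entry_star_hom PhiM i; rewrite -hm bb.
- by have [_ _ hs] := entry_star_hom PhiM i; rewrite -hs Cn_basis_star.
- have [hl _ _] := entry_star_hom PhiM i.
  by rewrite -(lin_sum hl) -Cn_cone_sum entry_one.
have [sigma ss] := unif_slice tp n At.
have : q (sigma (Phit (e_ j) (cone \ox cone)) - unif_state (e_ j) *: cone) = 0.
  have [_ _ qker _ _] := quot; apply/qker; apply: sub_gen_smallest.
  by exists sigma, (e_ j).
rewrite (slice_coords _ ss) unif_state_basis.
under eq_bigr do rewrite unif_state_basis.
have n0 : n%:R != 0 :> R[i] by rewrite pnatr_eq0 -lt0n.
rewrite -scaler_sumr -scalerBr (linZ ql) => /eqP.
rewrite scaler_eq0 invr_eq0 (negbTE n0) /= (linB ql) q1 subr_eq0 => /eqP <-.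
by rewrite (lin_sum ql); apply: eq_bigr => i _; rewrite entry_quotient.
Qed.

(** The kernel of f is a closed ideal, and it contains every generator: f sends the
    slice of Phit(m) to the sum over i and j of m_j b_ij / n, which is psi(m) 1 as
    the columns of b have sum 1. *)
Lemma preserving_gens_ker (B : unitalCstarType R) (b : 'I_n -> 'I_n -> B)
    (f : At -> B) :
  magic_relations b -> unital_star_hom f ->
  (forall i m, f (entry Phit i m) = \sum_j m ord0 j *: b i j) ->
  forall x, q x = 0 -> f x = 0.
Proof.
move=> [_ _ _ bc] fu fb x qx; have [[fl fm fs] f1] := fu.
have [_ _ qker _ _] := quot.
have /qker Jx := qx.
apply: (Jx [set x | f x = 0]); split; first exact: unital_star_hom_ker_ideal.
move=> _ [sigma [m [ss ->]]] /=.
rewrite (slice_coords _ ss) (linB fl) (linZ fl) f1 (lin_sum fl).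
apply/eqP; rewrite subr_eq0; apply/eqP.
under eq_bigr do rewrite (linZ fl) unif_state_basis fb.
rewrite -scaler_sumr exchange_big /= /unif_state scaler_suml scaler_sumr.
by apply: eq_bigr => j _; rewrite -scaler_sumr bc scalerA.
Qed.
End Preserving.
End Comparison.

Theorem mainTheorem12 (R : realType) (tp : minTensorProduct R)
  (n : nat) (hn : (1 <= n)%N)
  (* Aut(X_n) *)
  (A : unitalCstarType R) (a : 'I_n -> 'I_n -> A) (Delta : A -> tp A A -> tp A A)
  (hAut : @is_Aut R tp n A a Delta)
  (* Q-Map^psi(X_n) and its action on X_n *)
  (Ad : unitalCstarType R)
  (Phid : Cn R n -> tp (Cn R n) Ad -> tp (Cn R n) Ad)
  (Deltad : Ad -> tp Ad Ad -> tp Ad Ad)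
  (hQMap : @is_QMap R tp (Cn R n) Ad (@unif_state R n) Phid Deltad) :
  exists theta : A -> Ad,
    [/\ unital_star_hom theta,
        bijective theta,
        intertwines Delta Deltad theta
      & forall (j : 'I_n) (x : tp (Cn R n) Ad),
          Phid (Cn_basis R j) x =
          (\sum_i Cn_basis R i \ox theta (a i j) : tp (Cn R n) Ad) ** x].
Proof.
have [am univ DeltaM Delta_gen] := hAut.
have [At [Phit [q [[PhitM family] quot [PhidM qcomp] [[DeltadM coact] _]]]]] := hQMap.
have qu := quotient_unital quot; have [_ qsurj qker _ _] := quot.
have entq := entry_quotient quot qcomp.
pose v i j := entry Phid i (Cn_basis R j).
have vm : magic_relations v by exact: (entries_magic quot PhidM qcomp hn).
have [theta [[thetau thetaa] _]] := univ Ad v vm.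
have [thetah theta1] := thetau; have [thetal _ _] := thetah.
(* Psi(e_j) = sum_i e_i (x) a_ij, and lambda is the induced map At -> A *)
pose row i (m : Cn R n) := \sum_j m ord0 j *: a i j.
have rowh i : star_hom (row i) by exact: magic_row_star_hom.
pose PsiA (m : Cn R n) : tp (Cn R n) A := \sum_i Cn_basis R i \ox row i m.
have PsiAh : star_hom PsiA by exact: star_hom_of_coords.
have PsiA1 : PsiA cone = cone \ox cone.
  rewrite [RHS]tensor_decomp; apply: eq_bigr => i _; congr (_ \ox _).
  have [_ _ ar _] := am; rewrite mxE scale1r -[RHS](ar i).
  by apply: eq_bigr => j _; rewrite mxE scale1r.
have PsiM : Mor (to_mult PsiA) := to_mult_Mor (tens_one _) PsiAh PsiA1.
have [Lambda [[LM [K [KT Kc]]] _]] := family A _ PsiM.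
pose lambda x := Lambda x cone.
have lambdau : unital_star_hom lambda by exact: Mor_at_one.
have lambda_ent i m : lambda (entry Phit i m) = row i m.
  rewrite /lambda -(entry_comp i m LM KT Kc) /entry /to_mult.
  by rewrite (tens_one _).2 component_sum.
have lambda_ker x : q x = 0 -> lambda x = 0.
  exact: (preserving_gens_ker quot am lambdau lambda_ent).
have [mu [muu muq]] : exists mu : Ad -> A,
    unital_star_hom mu /\ forall x, mu (q x) = lambda x.
  by apply: (quotient_lift quot lambdau) => x /qker; exact: lambda_ker.
have row_basis i j : row i (Cn_basis R j) = a i j.
  rewrite /row (bigD1 j) //= mxE !eqxx scale1r big1 ?addr0 // => k kj.
  by rewrite mxE eqxx (negbTE kj) scale0r.
have mu_theta : cancel theta mu.
  apply: (Aut_ext hAut (f := mu \o theta) (g := id)) => [||i j] //=.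
    exact: unital_star_hom_comp.
  by rewrite thetaa /v entq muq lambda_ent row_basis.
have thl : unital_star_hom (theta \o lambda) by exact: unital_star_hom_comp.
(* theta o lambda and q both carry Phit to Phid *)
have theta_lambda x : theta (lambda x) = q x.
  have [L [_ Luniq]] := family Ad _ PhidM.
  have Lq : L = to_mult q by apply: Luniq; split=> //; exact: unital_Mor.
  suff Ltl : L = to_mult (theta \o lambda).
    rewrite -[RHS]cmul1r -[RHS]/(to_mult q x cone) -Lq Ltl.
    by rewrite /to_mult cmul1r.
  apply: Luniq; split; first exact: unital_Mor.
  apply: (amplification thl PhitM PhidM) => i m.
  have [el _ _] := entry_star_hom PhidM i.
  move: m; apply: (lin_basis_eq el) => [k m m'|j] /=.
    by rewrite !lambda_ent (let: And3 h _ _ := rowh i in h) thetal.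
  by rewrite lambda_ent row_basis thetaa.
have theta_mu : cancel mu theta.
  by move=> y; have [x <-] := qsurj y; rewrite muq theta_lambda.
exists theta; split=> //.
- by exists mu.
- have [muh _] := muu.
  have [Theta [Th Tt]] := tensor_iso (tp A A) (tp Ad Ad) thetah muh thetah muh
    mu_theta theta_mu mu_theta theta_mu.
  have T1 : Theta (cone \ox cone) = cone \ox cone by rewrite Tt !theta1.
  have [_ Tm _] := Th.
  have Dd_mul := Mor_mul (tens_one _) DeltadM.
  have D_mul := Mor_mul (tens_one _) DeltaM.
  have agree : forall x, Deltad (theta x) (cone \ox cone) =
                         Theta (Delta x (cone \ox cone)).
    have Dh := Mor_star_hom (tens_one _) DeltaM.
    have Ddh := Mor_star_hom (tens_one _) DeltadM.
    apply: (Aut_tensor_ext hAut).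
    + exact: star_hom_comp thetah Ddh.
    + exact: star_hom_comp Dh Th.
    + by rewrite theta1 (Mor_unit (tens_one _) DeltadM (cone_unit _)).
    + by rewrite (Mor_unit (tens_one _) DeltaM (cone_unit _)).
    move=> i j; rewrite thetaa (comult_entries _ _ PhidM DeltadM coact).
    rewrite Delta_gen (tens_one _).2; have [Tl _ _] := Th.
    by rewrite (lin_sum Tl); apply: eq_bigr => k _; rewrite Tt !thetaa.
  exists (to_mult Theta), (fun x => Deltad (theta x)); split.
  + split; first exact: to_mult_Mor (tens_one _) Th T1.
    by move=> x y z w; rewrite /to_mult Tt ptensM.
  + move=> x; split; first by case: DeltadM.
    by move=> b c; rewrite /to_mult Dd_mul agree cmulA -Tm -D_mul.
  + move=> x; split; first by case: DeltadM.
    by move=> b c; case: DeltadM => _ _ Dm _ _; rewrite /to_mult Dm.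
- move=> j x; rewrite (family_entries PhidM).
  by congr (_ ** _); apply: eq_bigr => i _; rewrite thetaa.
Qed.
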